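(* Let $D$ be a digraph and let $\omega$ be an end of $D$ that contains at least one ray but at most countably many pairwise disjoint rays (i.e. every set of pairwise disjoint rays in $\omega$ is countable). Then the combined in-degree $\Delta^-(\omega)$ of $\omega$ is equal to \[ \inf\left\{\liminf_{i\in\mathbb N}|U_i| \Bigm| (U_i)_{i\in\mathbb N}\text{ is an }\omega\text{-exhausting sequence}\right\}, \] where both values are considered in $\mathbb N\cup\{\infty\}$ (so that distinct infinite cardinals are not distinguished).
   Context: A dipath is a directed path. For vertex sets $A,B$, an $A$--$B$ dipath is a dipath that starts in $A$, ends in $B$ and is internally disjoint from $A\cup B$ (for subgraphs in place of $A$, $B$ take their vertex sets; for a vertex $v$ take $\{v\}$). A ray is a weakly connected digraph in which each vertex has in- and out-degree $1$ except one vertex (its starting vertex) which has in-degree $0$ and out-degree $1$; an anti-ray is the same with in- and out-degree interchanged, its exceptional vertex being its end vertex. Rays and anti-rays in $D$ are subdigraphs of $D$. A tail of a ray is a subray of it; a tail of an anti-ray is a sub-anti-ray of it. Disjoint means vertex-disjoint. For rays or anti-rays $Q,R$ of $D$, write $Q\le R$ if there are infinitely many pairwise disjoint $Q$--$R$ dipaths in $D$, and $Q\sim R$ if $Q\le R$ and $R\le Q$. This $\sim$ is an equivalence relation on the set of rays and anti-rays of $D$; its classes are the ends of $D$. For ends $\eta,\omega$ write $\eta\le\omega$ if $Q\le R$ for some (equivalently all) $Q\in\eta$, $R\in\omega$; write $\eta<\omega$ if $\eta\le\omega$ and $\eta\ne\omega$. The in-degree $d^-(\omega)$ of an end $\omega$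 is the maximum number of pairwise disjoint rays in $\omega$ if this is finite, and $\infty$ otherwise. Set $\omega^-:=\{\eta<\omega\mid \eta\text{ an end of }D,\ d^-(\eta)\ge 1\}$. For a vertex $v$ and a ray $R$, an infinite $v$--$R$ fan is an infinite family of $v$--$R$ dipaths that pairwise meet only in $v$. A vertex $v$ dominates an end $\omega$ if $\omega$ contains a ray and for every ray $R\in\omega$ there is an infinite $v$--$R$ fan and an $R$--$v$ dipath. $\mathrm{dom}(\omega)$ denotes the set of vertices dominating $\omega$. Let $X,Y$ be disjoint sets of ends of $D$ and $W\subseteq V(D)$. A set $S\subseteq V(D)$ separates $X$ from $Y$ if for every $\omega\in Y$ every $R\in\omega$ has a tail $Q$ such that every ray that lies in an element of $X$ and starts at a vertex of $Q$ meets $S$. $S$ separates $W$ from $Y$ if for every $\omega\in Y$ every $R\in\omega$ has a tail $Q$ such that every $Q$--$W$ dipath meets $S$. $S$ separates $X\cup W$ from $Y$ if it separates both $X$ and $W$ from $Y$. If $Y=\{\omega\}$ one says ''from $\omega$''. The combined in-degree of $\omega$ is \[\Delta^-(\omega):=d^-(\omega)+\inf\{|S|\mid S\subseteq V(D)\text{ separates }\omega^-\cup\mathrm{dom}(\omega)\text{ from }\omega\}.\] A sequence $(U_i)_{i\in\mathbb N}$ of finite vertex sets of $D$ is $\omega$-exhausting (for an end $\omega$ containing a ray) if for every ray in $\omega$ there exists $i\in\mathbb N$ such that this ray contains a vertex of $U_i$, and, for all $i$, every ray in $\omega$ that contains a vertex of $U_i$ also contains a vertex of $U_{i+1}$. 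*)

(* Defs.v *)
From HB Require Import structures.
From Stdlib Require Import Relation_Operators.
From mathcomp Require Import all_boot all_order all_algebra.
From mathcomp Require Import all_classical all_reals all_analysis.

Set Implicit Arguments.
Unset Strict Implicit.
Unset Printing Implicit Defensive.

Local Open Scope classical_set_scope.

(* Loops are allowed; no ray, anti-ray or dipath ever uses one.  Under the
   classical axioms of the library, asking for a choiceType of vertices and a
   boolean edge relation is no restriction. *)
Record digraph := Digraph { vertex :> choiceType; edge : rel vertex }.

Record subdigraph (D : digraph) := Subdigraph {
  verts : set D;
  arcs : D -> D -> Prop;
  arcsP : forall u v, arcs u v -> [/\ edge u v, verts u & verts v] }.

HB.instance Definition _ (D : digraph) := gen_eqMixin (subdigraph D).
HB.instance Definition _ (D : digraph) := gen_choiceMixin (subdigraph D).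

Section Ends.
Variable D : digraph.
Implicit Types (H Q R : subdigraph D) (A B W S : set D).
Implicit Types (omega eta : set (subdigraph D)) (X Y : set (set (subdigraph D))).

Definition sub_subdigraph H1 H2 : Prop :=
  verts H1 `<=` verts H2 /\ (forall u v, arcs H1 u v -> arcs H2 u v).

Definition weakly_connected H : Prop :=
  forall u v, verts H u -> verts H v -> clos_refl_sym_trans D (arcs H) u v.

Definition indegree_eq H (v : D) (k : nat) : Prop :=
  ([set u | arcs H u v] #= `I_k)%card.

Definition outdegree_eq H (v : D) (k : nat) : Prop :=
  ([set w | arcs H v w] #= `I_k)%card.

Definition ray_from H (x : D) : Prop :=
  [/\ weakly_connected H, verts H x, indegree_eq H x 0, outdegree_eq H x 1
    & forall v, verts H v -> v != x -> indegree_eq H v 1 /\ outdegree_eq H v 1].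

Definition is_ray H : Prop := exists x, ray_from H x.

Definition antiray_to H (x : D) : Prop :=
  [/\ weakly_connected H, verts H x, outdegree_eq H x 0, indegree_eq H x 1
    & forall v, verts H v -> v != x -> indegree_eq H v 1 /\ outdegree_eq H v 1].

Definition is_antiray H : Prop := exists x, antiray_to H x.

Definition is_line H : Prop := is_ray H \/ is_antiray H.

Definition tail Q R : Prop :=
  sub_subdigraph Q R /\ (is_ray R /\ is_ray Q \/ is_antiray R /\ is_antiray Q).

(* A dipath is given by its nonempty, duplicate-free sequence of vertices;
   the one-vertex dipath is allowed. *)
Definition dipath A B (s : seq D) : Prop :=
  if s is x :: p then
    [/\ path (@edge D) x p, uniq (x :: p), A x, B (last x p)
      & forall v, v \in x :: p -> v != x -> v != last x p -> ~ (A `|` B) v]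
  else False.

Definition meets A B : Prop := A `&` B !=set0.

Definition line_le Q R : Prop :=
  exists P : set (seq D),
    [/\ infinite_set P, P `<=` dipath (verts Q) (verts R)
      & trivIset P (fun s => [set` s])].

Definition line_equiv Q R : Prop := line_le Q R /\ line_le R Q.

Definition is_end omega : Prop :=
  exists2 Q, is_line Q & omega = [set R | is_line R /\ line_equiv Q R].

Definition end_le eta omega : Prop :=
  exists Q R, [/\ eta Q, omega R & line_le Q R].

Definition end_lt eta omega : Prop := end_le eta omega /\ eta <> omega.

Definition rays omega : set (subdigraph D) := omega `&` is_ray.

(* Values in N u {oo} live in the extended reals \bar K; for any set A,
   counting A is #|A| if A is finite and +oo otherwise. *)

Definition indegree (K : realType) omega : \bar K :=
  ereal_sup [set counting F | F in
    [set F : set (subdigraph D) | F `<=` rays omega /\ trivIset F (@verts D)]].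

Definition end_minus (K : realType) omega : set (set (subdigraph D)) :=
  [set eta | [/\ is_end eta, end_lt eta omega
    & (1 <= indegree K eta)%E]].

(* The fan is a set of dipaths, so that its members are distinct. *)
Definition infinite_fan (v : D) R (P : set (seq D)) : Prop :=
  [/\ infinite_set P, P `<=` dipath [set v] (verts R)
    & forall s t, P s -> P t -> s <> t -> [set` s] `&` [set` t] = [set v]].

Definition dominates (v : D) omega : Prop :=
  rays omega !=set0 /\
  forall R, rays omega R ->
    (exists P, infinite_fan v R P) /\ (exists s, dipath (verts R) [set v] s).

Definition dom omega : set D := [set v | dominates v omega].

Definition separates_ends S X Y : Prop :=
  forall omega, Y omega -> forall R, omega R ->
  exists2 Q, tail Q R &
    forall eta H x, X eta -> eta H -> ray_from H x -> verts Q x ->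
      meets (verts H) S.

Definition separates_verts S W Y : Prop :=
  forall omega, Y omega -> forall R, omega R ->
  exists2 Q, tail Q R &
    forall s, dipath (verts Q) W s -> meets [set` s] S.

Definition separates S X W Y : Prop :=
  separates_ends S X Y /\ separates_verts S W Y.

Definition combined_indegree (K : realType) omega : \bar K :=
  (indegree K omega + ereal_inf [set counting S | S in
    [set S | separates S (end_minus K omega) (dom omega) [set omega]]])%E.

Definition exhausting omega (U : nat -> set D) : Prop :=
  [/\ forall i, finite_set (U i),
      forall R, rays omega R -> exists i, meets (verts R) (U i)
    & forall i R, rays omega R ->
        meets (verts R) (U i) -> meets (verts R) (U i.+1)].

End Ends.

(* Main.v *)
(* Call a set cut off from the end when it can be separated from a tail of a fixed ray of
   [omega].

   Upper bound on the combined in-degree: let infinitely many sets of an exhausting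
   sequence have at most [k] vertices, let [S0] be a largest set contained in infinitely
   many of them, and let [h 0], ..., [h (d - 1)] be [d] disjoint rays of [omega]
   avoiding [S0].  Every vertex outside [S0] is in only finitely many of these sets, so
   every vertex that is reachable from the first ray off [S0] is cut off by all late ones.
   Hence such a vertex does not dominate [omega], and every ray of a smaller end that
   starts there meets all late ones; a maximal disjoint family of such rays is
   therefore finite, and finitely many vertices [F] separate the rays [h a] from it.
   For a late set [u] the part of [u] outside the rays [h a] then has at most [k - d]
   vertices and separates.

   Construction of an exhausting sequence: let [S] be a finite separating set and let [d]
   be the in-degree.  Off [S], only finitely far out can a ray of [omega] reach vertices
   sending an infinite fan to it, for otherwise [d + 1] disjoint rays of [omega] could jump
   from one such vertex to the next.  Beyond them every finite set [A] can be cut off by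
   [d] vertices: a smallest cut of size [N] is the set of starting vertices of [N] disjoint
   rays, grown one vertex at a time such that the current end vertices still cannot be cut
   off by fewer than [N] vertices.  These rays belong to [omega] because [S] separates.
   Iterating gives disjoint cuts [V i] moving towards the end, and [S] together with
   [V i] is exhausting. *)

Require Import Defs.
From mathcomp Require Import all_boot all_order all_algebra.
From mathcomp Require Import all_classical all_reals all_analysis.
From mathcomp Require Import finmap zify.

Set Implicit Arguments.
Unset Strict Implicit.
Unset Printing Implicit Defensive.

Local Open Scope classical_set_scope.

(** * Cuts and uncrossing *)

Lemma uniform_bound (T : eqType) (P : T -> nat -> Prop) (s : seq T) :
  (forall x m n, m <= n -> P x m -> P x n) ->
  (forall x, x \in s -> exists m, P x m) ->
  exists m, forall x, x \in s -> P x m.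
Proof.
move=> mono; elim: s => [|x s IH] h; first by exists 0.
have [|m hm] := IH; first by move=> y ys; apply: h; rewrite inE ys orbT.
have [k hk] := h x (mem_head _ _).
exists (maxn k m) => y; rewrite inE => /orP[/eqP->|ys].
  exact: mono (leq_maxl _ _) hk.
exact: mono (leq_maxr _ _) (hm y ys).
Qed.

Lemma ex_maximal_nat (P : nat -> Prop) n0 b :
  P n0 -> (forall n, P n -> n <= b) ->
  exists2 n, P n & forall m, P m -> m <= n.
Proof.
move=> P0 Pb; have ex : exists n, `[< P n >] by exists n0; apply/asboolP.
have bd i : `[< P i >] -> i <= b by move=> /asboolP/Pb.
case: (ex_maxnP ex bd) => n /asboolP Pn hn; exists n => // m Pm.
exact/hn/asboolP.
Qed.

Lemma ex_minimal_nat (P : nat -> Prop) :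
  (exists n, P n) -> exists2 n, P n & forall m, P m -> n <= m.
Proof.
move=> [n0 P0]; have ex : exists n, `[< P n >] by exists n0; apply/asboolP.
case: (ex_minnP ex) => n /asboolP Pn hn; exists n => // m Pm.
exact/hn/asboolP.
Qed.

(** * Directed walks and cuts *)

Section Connectivity.
Variable D : digraph.
Implicit Types (X : set D) (u v w x : D) (p : seq D).

(** The relation is directed and both end vertices must avoid [X]. Walks may repeat vertices, so
    that composition is concatenation. *)
Definition conn X u v : Prop :=
  exists p, [/\ path (@edge D) u p, last u p = v
    & forall x, x \in u :: p -> ~ X x].

Lemma conn_refl X u : ~ X u -> conn X u u.
Proof. by move=> Xu; exists [::]; split=> // x; rewrite inE => /eqP->. Qed.

Lemma conn_notl X u v : conn X u v -> ~ X u.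
Proof. by move=> [p [_ _ h]]; apply: h; rewrite mem_head. Qed.

Lemma conn_notr X u v : conn X u v -> ~ X v.
Proof. by move=> [p [_ <- h]]; apply: h; rewrite mem_last. Qed.

Lemma conn_trans X v u w : conn X u v -> conn X v w -> conn X u w.
Proof.
move=> [p [pu lu hp]] [q [qu lv hq]]; exists (p ++ q); split.
- by rewrite cat_path pu lu.
- by rewrite last_cat lu.
- move=> x; rewrite -cat_cons mem_cat => /orP[/hp//|xq].
  by apply: hq; rewrite inE xq orbT.
Qed.

Lemma conn_edge X u v : ~ X u -> ~ X v -> edge u v -> conn X u v.
Proof.
move=> Xu Xv e; exists [:: v]; split=> //=; first by rewrite e.
by move=> x; rewrite !inE => /orP[] /eqP->.
Qed.

Lemma conn_mono X X' u v : X `<=` X' -> conn X' u v -> conn X u v.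
Proof. by move=> XX [p [pu lu h]]; exists p; split=> // x /h h1 /XX. Qed.

Lemma path_conn_suffix X u p x : path (@edge D) u p -> x \in u :: p ->
  (forall y, y \in u :: p -> ~ X y) -> conn X x (last u p).
Proof.
elim: p u => [|w p IH] u /=.
  by move=> _; rewrite inE => /eqP-> h; apply/conn_refl/h; rewrite mem_head.
move=> /andP[e pw]; rewrite inE => /orP[/eqP->|xp] h.
  by exists (w :: p); split=> //=; rewrite e.
by apply: IH => // y yp; apply: h; rewrite inE yp orbT.
Qed.

Lemma path_conn_prefix X u p x : path (@edge D) u p -> x \in u :: p ->
  (forall y, y \in u :: p -> ~ X y) -> conn X u x.
Proof.
elim: p u => [|w p IH] u /=.
  by move=> _; rewrite inE => /eqP-> h; apply/conn_refl/h; rewrite mem_head.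
move=> /andP[e pw]; rewrite inE => /orP[/eqP->|xp] h.
  by apply/conn_refl/h; rewrite mem_head.
apply: (@conn_trans _ w).
  by apply: conn_edge => //; apply: h; rewrite !inE eqxx ?orbT.
by apply: IH => // y yp; apply: h; rewrite inE yp orbT.
Qed.

(** A walk meeting [Y] is split at its last vertex in [Y], so that the remainder avoids [Y]. *)
Lemma conn_last X Y u w : conn X u w ->
  conn (X `|` Y) u w \/
  exists v q, [/\ Y v, conn X u v, path (@edge D) v q, last v q = w
    & (forall x, x \in v :: q -> ~ X x) /\ forall x, x \in q -> ~ Y x].
Proof.
move=> [p [pu lu h]]; elim: p u pu lu h => [|a p IH] u /=.
  move=> _ <- h; have Xu : ~ X u by apply: h; rewrite mem_head.
  have [Yu|Yu] := pselect (Y u); last by left; apply: conn_refl => -[].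
  by right; exists u, [::]; split=> //; exact: conn_refl.
move=> /andP[e pa] la h.
have Xu : ~ X u by apply: h; rewrite mem_head.
have h' x : x \in a :: p -> ~ X x by move=> xp; apply: h; rewrite inE xp orbT.
have Xa : ~ X a by apply: h'; rewrite mem_head.
have [c|[v [q [Yv av qv lv hq]]]] := IH a pa la h'; last first.
  right; exists v, q; split=> //; apply: conn_trans av; exact: conn_edge.
case: (c) => q [pq lq hq]; have [Yu|Yu] := pselect (Y u); last first.
  left; apply: (@conn_trans _ a); last by exists q.
  by apply: conn_edge => //; [case | apply: hq; rewrite mem_head].
right; exists u, (a :: q); split=> //=; rewrite ?e//; first exact: conn_refl.
split=> x; last by move=> /hq xq Yx; apply: xq; right.
by rewrite inE => /orP[/eqP->//|/hq xq Xx]; apply: xq; left.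
Qed.

Lemma conn_meet X Y u w : conn X u w ->
  conn (X `|` Y) u w \/ exists v, [/\ Y v, conn X u v & conn X v w].
Proof.
move=> /(@conn_last _ Y)[|[v [q [Yv uv pq lq [hq _]]]]]; [by left|right].
by exists v; split=> //; exists q.
Qed.

(* The target is the decreasing family [Q]: the tails of a ray, or a constant set. *)
Section Cut.
Variable Q : nat -> set D.
Hypothesis Qdec : forall m n, m <= n -> Q n `<=` Q m.

Definition rch X v m : Prop := exists2 w, Q m w & conn X v w.
(** For the tails of a ray this says that [X] separates [v] from some tail. Vertices of [X] count as
    cut off. *)
Definition cut X v : Prop := exists m, ~ rch X v m.

Lemma rch_mono X X' v m n : X `<=` X' -> m <= n -> rch X' v n -> rch X v m.
Proof.
by move=> XX mn [w Qw c]; exists w; [exact: Qdec Qw | exact: conn_mono c].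
Qed.

Lemma cut_mono X X' v : X `<=` X' -> cut X v -> cut X' v.
Proof. by move=> XX [m h]; exists m => /(rch_mono XX (leqnn m)). Qed.

Lemma rch_notin X v m : rch X v m -> ~ X v.
Proof. by move=> [w _ /conn_notl]. Qed.

Lemma cut_in X v : X v -> cut X v.
Proof. by move=> Xv; exists 0 => /rch_notin. Qed.

Lemma rch_conn X u v m : conn X u v -> rch X v m -> rch X u m.
Proof. by move=> c [w Qw c']; exists w => //; exact: conn_trans c'. Qed.

Lemma cut_conn X u v : conn X u v -> cut X u -> cut X v.
Proof. by move=> c [m h]; exists m => /(rch_conn c). Qed.

Lemma cut_edge X u v : ~ X u -> edge u v -> cut X u -> cut X v.
Proof.
move=> Xu e cu; have [Xv|Xv] := pselect (X v); first exact: cut_in.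
exact: cut_conn (conn_edge Xu Xv e) cu.
Qed.

Lemma not_cut X v : ~ cut X v -> forall m, rch X v m.
Proof. by move=> h m; apply: contra_notP h => h; exists m. Qed.

(** Larger indices are harder to reach, so finitely many witnesses can be replaced by a common
    one. *)
Lemma cut_uniform (s : seq D) (X : D -> set D) :
  exists m, forall v, v \in s -> cut (X v) v -> ~ rch (X v) v m.
Proof.
apply: uniform_bound => [x m n mn h c /(rch_mono _ mn) r|x _].
  by apply: (h c); apply: r.
by have [[m h]|h] := pselect (cut (X x) x); [exists m | exists 0].
Qed.

Definition lset Y : set D := [set x | x \in (Y : seq D)].

(** * Submodularity of cuts *)

Section Uncross.
Variables (Z : set D) (A : set D) (n : nat).
Hypothesis low : forall Y, (forall a, A a -> cut (Z `|` lset Y) a) -> n <= size Y.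

(** Submodularity: [Y] bounds the union of the two cut-off regions and [Y'] their intersection, and
    their sizes add up to at most [n + n]. As [Y'] still cuts off [A], it has at least [n] vertices,
    which leaves at most [n] for [Y]. *)
Lemma uncross Y1 Y2 : size Y1 <= n -> size Y2 <= n ->
  (forall a, A a -> cut (Z `|` lset Y1) a) ->
  (forall a, A a -> cut (Z `|` lset Y2) a) ->
  exists Y, [/\ size Y <= n, forall v, cut (Z `|` lset Y1) v -> cut (Z `|` lset Y) v
    & forall v, cut (Z `|` lset Y2) v -> cut (Z `|` lset Y) v].
Proof.
move=> s1 s2 c1 c2.
set C1 := cut (Z `|` lset Y1) in c1 *; set C2 := cut (Z `|` lset Y2) in c2 *.
(* [i2] and [i1] select the vertices strictly inside a region. A vertex common to [Y1] and [Y2] goes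
   once into [Y] and once into [Y']. *)
pose i2 y := `[< C2 y >] && (y \notin Y2).
pose i1 y := `[< C1 y >] && (y \notin Y1).
pose Y := seq.filter (predC i2) Y1 ++ seq.filter (predC i1) (seq.filter (fun y => y \notin Y1) Y2).
pose Y' := seq.filter i2 Y1 ++ seq.filter (fun y => `[< C1 y >]) Y2.
have szE : size Y + size Y' <= n + n.
  rewrite !size_cat !size_filter -[X in X <= _]addnACA.
  rewrite [count (predC i2) Y1 + _]addnC count_predC; apply: leq_add => //.
  rewrite -count_filter -!size_filter -!filter_predI.
  rewrite !size_filter; apply: leq_trans s2.
  rewrite -[leqRHS](count_predC (fun y => `[< C1 y >])) addnC leq_add2l.
  apply: sub_count => y /=; rewrite /i1 => /andP[].
  by case: (y \in Y1) => //=; rewrite andbT.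
have Y'cut a : A a -> cut (Z `|` lset Y') a.
  move=> Aa; apply: contrapT => /not_cut nc.
  have [m1 h1] := c1 a Aa; have [w Qw [p [pa lp hp]]] := nc m1.
  (* Inside both regions every vertex of [Y1] or [Y2] belongs to [Y']. Hence a walk from [A] off [Z]
     and [Y'] stays in both regions and never meets [Y1]. *)
  have off x : C1 x -> C2 x -> ~ lset Y' x -> x \notin Y1 /\ x \notin Y2.
    move=> k1 k2 nY'; have n2 : x \notin Y2.
      apply/negP => xY; apply: nY'; rewrite /lset /= mem_cat !mem_filter xY.
      by rewrite (asboolT k1) orbT.
    split=> //; apply/negP => xY; apply: nY'.
    by rewrite /lset /= mem_cat mem_filter xY /i2 n2 (asboolT k2).
  apply: h1; exists w => //; exists p; split=> // {w Qw lp nc}.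
  have := c2 a Aa; have := c1 a Aa; rewrite -/(C1 a) -/(C2 a) => {Aa}.
  elim: p a pa hp => [|b p IH] a /=; [move=> _|move=> /andP[e pb]] => hp k1 k2.
    move=> x; rewrite inE => /eqP-> [Zx|/= x1].
      by apply: (hp a); [rewrite mem_head | left].
    have [|n1 _] := off _ k1 k2; last by rewrite x1 in n1.
    by move=> y'; apply: (hp a); [rewrite mem_head | right].
  have Za : ~ Z a by move=> Za; apply: (hp a); [rewrite mem_head | left].
  have [|n1 n2] := off _ k1 k2.
    by move=> y'; apply: (hp a); [rewrite mem_head | right].
  move=> x; rewrite inE => /orP[/eqP-> []//=|]; first by rewrite /lset /= (negPf n1).
  apply: IH => //.
  - by move=> y yp; apply: hp; rewrite inE yp orbT.
  - by apply: cut_edge e k1 => -[]//=; rewrite /lset /= (negPf n1).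
  - by apply: cut_edge e k2 => -[]//=; rewrite /lset /= (negPf n2).
have main v : C1 v \/ C2 v -> cut (Z `|` lset Y) v.
  move=> Cv; apply: contrapT => /not_cut nc.
  have [ma ha] := cut_uniform (v :: Y1 ++ Y2) (fun _ => Z `|` lset Y1).
  have [mb hb] := cut_uniform (v :: Y1 ++ Y2) (fun _ => Z `|` lset Y2).
  pose m := maxn ma mb.
  have {}ha u : u \in v :: Y1 ++ Y2 -> C1 u -> ~ rch (Z `|` lset Y1) u m.
    by move=> uI Cu r; apply: (ha u uI Cu); apply: rch_mono r => //; exact: leq_maxl.
  have {}hb u : u \in v :: Y1 ++ Y2 -> C2 u -> ~ rch (Z `|` lset Y2) u m.
    by move=> uI Cu r; apply: (hb u uI Cu); apply: rch_mono r => //; exact: leq_maxr.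
  have [w Qw cw] := nc m.
  (* After its last vertex [u] in [Y1] or [Y2] the walk avoids both. Since [u] is not in [Y], it
     lies strictly inside one of the regions, and the remainder of the walk contradicts this. *)
  have [c|[u [q [uY cu pq lq [hq hqY]]]]] := conn_last (lset (Y1 ++ Y2)) cw.
    case: Cv => [/(ha _ (mem_head _ _))|/(hb _ (mem_head _ _))]; apply;
      exists w => //; apply: conn_mono c => x [Zx|xY]; do ?[by left; left];
      by right; rewrite /lset /= mem_cat; move: xY; rewrite /lset /= => ->;
      rewrite ?orbT.
  have uY'' : u \notin Y by apply/negP => uY''; apply: (conn_notr cu); right.
  have Zoff x : x \in u :: q -> ~ Z x by move=> /hq h Zx; apply: h; left.
  have uI : u \in v :: Y1 ++ Y2 by rewrite inE orbC uY.
  have qn x : x \in q -> (x \notin Y1) && (x \notin Y2).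
    by move=> /hqY /negP; rewrite /lset /= mem_cat negb_or.
  move: uY''; rewrite mem_cat !mem_filter /= negb_or.
  case: (boolP (u \in Y2)) => u2; rewrite /i1 /i2 ?u2 !(andbF, andbT, orbF) /=.
    case: (boolP (u \in Y1)) => //= u1; rewrite ?andbT negbK => /asboolP k1.
    case: (ha u uI k1); exists w => //; exists q; split=> // x.
    rewrite inE => /predU1P[->|xq]; last first.
      have /andP[n1 _] := qn _ xq; case=> [|/=]; last by rewrite /lset /= (negPf n1).
      by apply: Zoff; rewrite inE xq orbT.
    by case=> [|/=]; [apply: Zoff; rewrite mem_head | rewrite /lset /= (negPf u1)].
  have u1 : u \in Y1 by move: uY; rewrite /lset /= mem_cat (negPf u2) orbF.
  rewrite u1 ?andbT negbK => /asboolP k2.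
  case: (hb u uI k2); exists w => //; exists q; split=> // x.
  rewrite inE => /predU1P[->|xq]; last first.
    have /andP[_ n2] := qn _ xq; case=> [|/=]; last by rewrite /lset /= (negPf n2).
    by apply: Zoff; rewrite inE xq orbT.
  by case=> [|/=]; [apply: Zoff; rewrite mem_head | rewrite /lset /= (negPf u2)].
exists Y; split; [|by move=> v Cv; apply: main; left|by move=> v Cv; apply: main; right].
have := low Y'cut; lia.
Qed.
End Uncross.

(** * One step of a growing path *)

Section OneStep.
Variable n : nat.
Implicit Types (Z : set D) (c : 'I_n -> D).

(** Menger's condition for [n] disjoint walks from the points [c i] to the target off [Z]. *)
Definition big Z c : Prop :=
  forall Y, size Y < n -> exists i, ~ cut (Z `|` lset Y) (c i).

Definition upd c (i : 'I_n) (y : D) : 'I_n -> D := fun j => if j == i then y else c j.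

(** These [n.-1] vertices cut off every point but [c i]; under [big] they therefore leave [c i]
    uncut. *)
Definition others c (i : 'I_n) : seq D := [seq c j | j <- rem i (enum 'I_n)].

Lemma size_others c i : size (others c i) = n.-1.
Proof. by rewrite size_map size_rem ?mem_enum// size_enum_ord. Qed.

Lemma mem_others c i j : j != i -> c j \in others c i.
Proof.
by move=> ji; apply: map_f; rewrite mem_rem_uniq ?enum_uniq// inE ji mem_enum.
Qed.

Lemma size_others_lt c i : size (others c i) < n.
Proof. by rewrite size_others ltn_predL (leq_ltn_trans _ (ltn_ord i)). Qed.

Lemma big_notin Z c i : big Z c -> ~ Z (c i).
Proof.
move=> bg Zc; have [j] := bg _ (size_others_lt c i).
apply; have [->|ji] := eqVneq j i; first by apply: cut_in; left.
by apply: cut_in; right; exact: mem_others.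
Qed.

Lemma big_inj Z c : big Z c -> injective c.
Proof.
move=> bg i k cik; apply: contrapT => /eqP ik.
have [j] := bg _ (size_others_lt c i).
apply; apply: cut_in; right.
have [->|ji] := eqVneq j i; last exact: mem_others.
by rewrite cik; apply: mem_others; rewrite eq_sym.
Qed.

(* Among the sets of [n - 1] vertices cutting the other points, any two are dominated
   by a third one; a large one would cut [c i] as well if no successor of [c i] worked. *)
Lemma one_step Z c i (B : seq D) m0 : big Z c -> c i \notin B ->
  ~ rch (Z `|` lset B) (c i) m0 ->
  exists2 y, edge (c i) y & big (Z `|` [set c i]) (upd c i y).
Proof.
move=> bg; set x := c i => xB nx; apply: contrapT => none.
have n0 : 0 < n := leq_ltn_trans (leq0n i) (ltn_ord i).
pose Zx := Z `|` [set x].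
pose A : set D := [set a | exists2 j, j != i & a = c j].
(* Together with [x] such a set cuts off all [n] points. This is the lower bound that [uncross]
   needs. *)
have low Y : (forall a, A a -> cut (Zx `|` lset Y) a) -> n.-1 <= size Y.
  move=> h; rewrite leqNgt; apply/negP => sY.
  have [|j] := bg (x :: Y); first by rewrite /=; lia.
  apply; have [->|ji] := eqVneq j i.
    by apply: cut_in; right; rewrite /lset /= mem_head.
  apply: cut_mono (h _ _); last by exists j.
  move=> v [[Zv|->]|vY]; [by left|right|right]; rewrite /lset /= inE ?eqxx//.
  by move: vY; rewrite /lset /= => ->; rewrite orbT.
pose fam Y := size Y <= n.-1 /\ forall a, A a -> cut (Zx `|` lset Y) a.
pose CC v := exists2 Y, fam Y & cut (Zx `|` lset Y) v.
have fam0 : exists Y, fam Y.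
  exists (others c i); split; first by rewrite size_others.
  by move=> _ [j ji ->]; apply: cut_in; right; exact: mem_others.
have dir (L : seq D) : (forall v, v \in L -> CC v) ->
    exists2 Y, fam Y & forall v, v \in L -> cut (Zx `|` lset Y) v.
  elim: L => [|v L IH] h; first by have [Y fY] := fam0; exists Y.
  have [|Y1 f1 h1] := IH; first by move=> u uL; apply: h; rewrite inE uL orbT.
  have [Y2 f2 h2] := h v (mem_head _ _).
  have [Y [sY k1 k2]] := uncross low f1.1 f2.1 f1.2 f2.2.
  exists Y; first by split=> // a Aa; apply: k1; exact: f1.2.
  by move=> u; rewrite inE => /predU1P[->|uL]; [exact: k2 | apply: k1; exact: h1].
(* The small set showing that [y] fails is itself a member of [fam], and it cuts off [y]. *)
have nb y : edge x y -> CC y.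
  move=> e; apply: contra_notP none => nC; exists y => // Y sY.
  apply: contrapT => all; apply: nC; exists Y.
    split; first by lia.
    move=> _ [j ji ->]; apply: contrapT => h; apply: all; exists j.
    by rewrite /upd (negPf ji).
  by apply: contrapT => h; apply: all; exists i; rewrite /upd eqxx.
(* The vertices lying in every member that cuts them off. By [dir], finitely many of them share a
   member, so there are at most [n.-1]. *)
pose K v := CC v /\ forall Y, fam Y -> cut (Zx `|` lset Y) v -> v \in Y.
have [L [LK KL]] : exists L : seq D, (forall v, v \in L -> K v) /\ forall v, K v -> v \in L.
  pose P k := exists2 L, uniq L /\ size L = k & forall v : D, v \in L -> K v.
  have [||k [L [uL sL] LK] kmax] := @ex_maximal_nat P 0 n.-1.
  - by exists [::].
  - move=> k [L [uL <-] LK]; have [|Y fY hY] := dir L.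
      by move=> v /LK[].
    apply: leq_trans fY.1; apply: uniq_leq_size => // v vL.
    by have [_ h] := LK v vL; apply: h => //; exact: hY.
  - exists L; split=> // v Kv; apply: contrapT => /negP vL.
    have : k.+1 <= k; last by rewrite ltnn.
    apply: kmax; exists (v :: L); first by rewrite /= vL uL sL.
    by move=> u; rewrite inE => /predU1P[->|/LK].
have [|Y fY hY] := dir (L ++ seq.filter (fun b => `[< CC b >]) B).
  by move=> v; rewrite mem_cat mem_filter => /orP[/LK[]//|/andP[/asboolP]].
have KY v : K v -> v \in Y.
  by move=> Kv; apply: (Kv.2 _ fY); apply: hY; rewrite mem_cat KL.
have BY v : v \in B -> CC v -> cut (Zx `|` lset Y) v.
  by move=> vB Cv; apply: hY; rewrite mem_cat mem_filter vB asboolT ?orbT.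
(* Otherwise a walk leaves [x] for good and, by the choice of [B], meets [B]. It avoids [K], so
   being cut off by some member passes from each of its vertices to the next. The vertex in [B] is
   then cut off by [Y], although the walk goes on to the target off [Y]. *)
have cx : cut (Z `|` lset Y) x.
  apply: contrapT => /not_cut r.
  have [m1 h1] := cut_uniform B (fun _ => Zx `|` lset Y).
  have [w Qw c1] := r (maxn m0 m1).
  case: (conn_last [set x] c1) => [/conn_notl|[v [q [-> _ pq lq [hq qx]]]]].
    by apply; right.
  have [b bq bB] : exists2 b, b \in q & b \in B.
    apply: contrapT => nB; apply: nx; exists w; first exact: Qdec (leq_maxl _ _) _ Qw.
    exists q; split=> // u uq [Zu|uB]; first by apply: (hq u uq); left.
    move: uq; rewrite inE => /predU1P[ux|uq]; first by move: uB xB; rewrite ux /lset /= => ->.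
    by apply: nB; exists u.
  have qC : forall u p, CC u -> path (@edge D) u p ->
      (forall v, v \in u :: p -> ~ (Z `|` lset Y) v /\ v <> x) ->
      forall v, v \in u :: p -> CC v.
    move=> u p; elim: p u => [|a p IH] u Cu /=.
      by move=> _ _ ?; rewrite inE => /eqP->.
    move=> /andP[e pa] h z; rewrite inE => /predU1P[->//|].
    apply: IH => //; last by move=> t tp; apply: h; rewrite inE tp orbT.
    have [hu ux] := h u (mem_head _ _).
    have [Y' fY' [c' uY']] : exists2 Y', fam Y' & cut (Zx `|` lset Y') u /\ u \notin Y'.
      apply: contrapT => no; apply: hu; right; apply: KY; split=> // Y' fY' cu.
      by apply: contrapT => /negP ?; apply: no; exists Y'.
    exists Y' => //; apply: cut_edge e c' => -[[Zu|//]|]; last by rewrite /lset /= (negPf uY').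
    by apply: hu; left.
  have Cb : CC b.
    case: q pq lq hq qx bq => // a q /= /andP[e pa] la hq qx bq.
    apply: (qC a q (nb _ e) pa _ b bq) => z zq; split; last exact: qx.
    by apply: hq; rewrite inE zq orbT.
  apply: (h1 b bB (BY b bB Cb)); exists w; first exact: Qdec (leq_maxr _ _) _ Qw.
  case: q pq lq hq qx bq => // a q /= /andP[e pa] la hq qx bq.
  rewrite -la; apply: path_conn_suffix => // z zq [[Zz|/= zx]|zY].
  - by apply: (hq z); [rewrite inE zq orbT | left].
  - exact: (qx z zq zx).
  - by apply: (hq z); [rewrite inE zq orbT | right].
(* Any walk from another point off [Z] and [Y] passes through [x] or is stopped by [Y], so [Y] cuts
   off all points with fewer than [n] vertices. *)
have [|j] := bg Y; first by have := fY.1; lia.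
apply; have [->//|ji] := eqVneq j i.
have [m1 h1] := cx; have [|m2 h2] := fY.2 (c j); first by exists j.
exists (maxn m1 m2) => -[w Qw c1].
have [c2|[_ [-> _ c2]]] := conn_meet [set x] c1.
  apply: h2; exists w; first exact: Qdec (leq_maxr _ _) _ Qw.
  by apply: conn_mono c2 => v [[Zv|->]|vY]; [left; left|right|left; right].
by apply: h1; exists w => //; exact: Qdec (leq_maxl _ _) _ Qw.
Qed.
End OneStep.
End Cut.
End Connectivity.

(** * Growing disjoint paths *)

Lemma count_ltn (T : eqType) (a b : pred T) (s : seq T) (x : T) :
  subpred a b -> x \in s -> b x -> ~~ a x -> count a s < count b s.
Proof.
move=> ab; elim: s => //= y s IH; rewrite inE => /predU1P[<-|xs] bx ax.
  by rewrite bx (negPf ax) add0n add1n ltnS sub_count.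
rewrite -addnS; apply: leq_add; last exact: IH.
by have := ab y; case: (a y) => // ->.
Qed.

Section Tokens.
Variables (D : digraph) (n : nat).
Implicit Types (Z : seq D) (c : 'I_n -> D) (l : 'I_n -> seq D) (G : set D).

(* [n] disjoint paths growing at their last vertices [c i]; [l i] lists the earlier
   vertices of the [i]-th path backwards, and [Z] contains all of them. *)
Definition valid Z c l : Prop :=
  [/\ forall i, path (fun x y => @edge D y x) (c i) (l i),
      forall i, uniq (c i :: l i),
      forall i, c i \notin Z,
      forall i x, x \in l i -> x \in Z
    & forall i j x, x \in c i :: l i -> x \in c j :: l j -> i = j].

Definition ext G c l Z' c' l' : Prop :=
  valid Z' c' l' /\
  forall i, exists2 p, c' i :: l' i = p ++ c i :: l i & forall x, x \in p -> G x.

Lemma ext_refl G Z c l : valid Z c l -> ext G c l Z c l.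
Proof. by move=> v; split=> // i; exists [::]. Qed.

Lemma ext_trans G c1 l1 Z2 c2 l2 Z3 c3 l3 :
  ext G c1 l1 Z2 c2 l2 -> ext G c2 l2 Z3 c3 l3 -> ext G c1 l1 Z3 c3 l3.
Proof.
move=> [v2 h2] [v3 h3]; split=> // i.
have [p e2 pG] := h2 i; have [q e3 qG] := h3 i.
exists (q ++ p); first by rewrite e3 e2 catA.
by move=> x; rewrite mem_cat => /orP[/qG|/pG].
Qed.

Lemma ext_mono G G' c l Z' c' l' : G `<=` G' -> ext G c l Z' c' l' -> ext G' c l Z' c' l'.
Proof.
by move=> GG [v h]; split=> // i; have [p e pG] := h i; exists p => // x /pG/GG.
Qed.

Definition push c l (i : 'I_n) : 'I_n -> seq D := fun j => if j == i then c i :: l i else l j.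

Lemma ext_step G Z c l i y : valid Z c l -> edge (c i) y -> y \notin Z ->
  (forall j, y != c j) -> G y -> ext G c l (c i :: Z) (upd c i y) (push c l i).
Proof.
move=> [vp vu vZ vl vd] e yZ yc Gy; split; last first.
  move=> j; rewrite /upd /push; have [->|ji] := eqVneq j i.
    by exists [:: y] => // x; rewrite inE => /eqP->.
  by exists [::].
have cl j : y \notin c j :: l j.
  by rewrite inE (negPf (yc j)) /=; apply: contra yZ => /vl.
split.
- by move=> j; rewrite /upd /push; have [_|_] := eqVneq j i; rewrite //= e vp.
- move=> j; rewrite /upd /push; have [_|_] := eqVneq j i; last exact: vu.
  by rewrite cons_uniq cl vu.
- move=> j; rewrite /upd; have [_|ji] := eqVneq j i.
    by rewrite inE negb_or yc.
  rewrite inE negb_or vZ andbT; apply: contra ji => /eqP cc.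
  by apply/eqP/(vd _ _ (c i)); rewrite -?cc mem_head.
- move=> j x; rewrite /push inE; have [_|_] := eqVneq j i.
    by rewrite inE => /predU1P[->|/vl ->]; rewrite ?eqxx ?orbT.
  by move=> /vl->; rewrite orbT.
- have h j k x : x \in upd c i y j :: push c l i j -> x \in upd c i y k :: push c l i k ->
    x <> y -> j = k.
    move=> xj xk xy; apply: (vd _ _ x).
      move: xj; rewrite /upd /push; have [->|//] := eqVneq j i.
      by rewrite inE => /predU1P[].
    move: xk; rewrite /upd /push; have [->|//] := eqVneq k i.
    by rewrite inE => /predU1P[].
  move=> j k x xj xk; have [xy|xy] := pselect (x = y); last exact: h xj xk xy.
  have yi j' : y \in upd c i y j' :: push c l i j' -> j' = i.
    rewrite /upd /push; have [->//|_] := eqVneq j' i.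
    by rewrite (negPf (cl _)).
  by rewrite xy in xj xk; rewrite (yi _ xj) (yi _ xk).
Qed.

Lemma valid_cons Z c l w : valid Z c l -> (forall i, c i != w) -> valid (w :: Z) c l.
Proof.
move=> [vp vu vZ vl vd] wc; split=> //.
  by move=> i; rewrite inE negb_or wc vZ.
by move=> i x /vl xZ; rewrite inE xZ orbT.
Qed.

Lemma big_mono (Q : nat -> set D) (Qdec : forall m n, m <= n -> Q n `<=` Q m)
  (X X' : set D) c : X `<=` X' -> big Q X' c -> big Q X c.
Proof.
move=> XX bg Y sY; have [i h] := bg Y sY; exists i => cX; apply: h.
by apply: (cut_mono Qdec _ cX) => x [/XX|]; [left | right].
Qed.

(** * Linking into a finite target *)

Section Finite.
Variable T : seq D.
Let QT : nat -> set D := fun=> lset T.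
Let QTdec (m k : nat) : m <= k -> QT k `<=` QT m. Proof. by move=> _ x. Qed.

(* Compactness: a largest set [K] that extends to small cuts inside arbitrarily large
   finite sets would be a small cut of the whole digraph. *)
Lemma big_finite (Z : set D) c : big QT Z c -> exists W : seq D, big QT (Z `|` ~` lset W) c.
Proof.
move=> bg; apply: contrapT => none.
have small (W : seq D) : exists2 Y, size Y < n &
    forall i, cut QT (Z `|` ~` lset W `|` lset Y) (c i).
  apply: contrapT => h; apply: none; exists W => Y sY.
  by apply: contrapT => all; apply: h; exists Y => // i; apply: contrapT => nc; apply: all; exists i.
pose good (K : seq D) := forall W : seq D, exists W' Y : seq D, [/\ {subset W <= W'}, {subset K <= Y}, size Y < n
   & forall i, cut QT (Z `|` ~` lset W' `|` lset Y) (c i)].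
pose P k := exists2 K, uniq K /\ size K = k & good K.
have [||k [K [uK sK] gK] kmax] := @ex_maximal_nat P 0 n.
- by exists [::] => // W; have [Y sY hY] := small W; exists W, Y; split=> // x; rewrite in_nil.
- move=> k [K [uK <-] gK]; have [W' [Y [_ KY sY _]]] := gK [::].
  exact: leq_trans (uniq_leq_size uK KY) (ltnW sY).
have [i nc] : exists i, ~ cut QT (Z `|` lset K) (c i).
  apply: bg; have [W' [Y [_ KY sY _]]] := gK [::].
  exact: leq_ltn_trans (uniq_leq_size uK KY) sY.
have [w Tw [p [pc lp hp]]] := not_cut nc 0.
(* By maximality of [K] no vertex [v] of the walk can be added to it; [f v] is a finite set none of
   whose finite supersets has a small cut containing [v :: K]. *)
have [f hf] : exists f : D -> seq D, forall v, v \in c i :: p -> ~ exists W' Y : seq D,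
    [/\ {subset f v <= W'}, {subset v :: K <= Y}, size Y < n
      & forall i, cut QT (Z `|` ~` lset W' `|` lset Y) (c i)].
  have h v : exists W : seq D, v \in c i :: p -> ~ exists W' Y : seq D,
    [/\ {subset W <= W'}, {subset v :: K <= Y}, size Y < n
      & forall i, cut QT (Z `|` ~` lset W' `|` lset Y) (c i)].
    have [vp|] := boolP (v \in c i :: p); last by exists [::].
    have vK : v \notin K by apply/negP => vK; apply: (hp v vp); right.
    apply: contrapT => no; have : k.+1 <= k; last by rewrite ltnn.
    apply: kmax; exists (v :: K); first by rewrite /= vK uK sK.
    by move=> W; apply: contrapT => nW; apply: no; exists W.
  by have [f hf] := choice h; exists f.
(* Inside a finite set containing the walk and all the [f v], the cut [Y] must meet the walk, and
   the vertex where it does contradicts the choice of [f v]. *)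
have [W' [Y [sW KY sY cY]]] := gK (c i :: p ++ flatten [seq f v | v <- c i :: p]).
have [m] := cY i; apply; exists w => //; exists p; split=> // v vp [[Zv|]|vY].
- by apply: (hp v vp); left.
- by apply; apply: sW; rewrite -cat_cons mem_cat vp.
- apply: (hf v vp); exists W', Y; split=> //.
    move=> x xf; apply: sW; rewrite -cat_cons mem_cat; apply/orP; right.
    by apply/flattenP; exists (f v) => //; apply: map_f.
  by move=> x; rewrite inE => /predU1P[->//|/KY].
Qed.

(** Everything outside [W] is forbidden, so each step uses up a vertex of [W] and the process ends.
    Only paths not yet ending in [T] are extended, with [T] as the blocking set of [one_step]. *)
Lemma link_into (Z0 Z W : seq D) c l (I : set D) : {subset Z0 <= Z} ->
  valid Z c l -> big QT (lset Z `|` ~` lset W) c ->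
  (forall u v, I u -> u \notin T -> u \notin Z0 -> edge u v -> v \notin Z0 -> I v) ->
  (forall i, I (c i)) ->
  exists Z' c' l', [/\ ext I c l Z' c' l', {subset Z <= Z'}, forall i, c' i \in T
    & forall u, u \in Z' -> u \in Z \/ I u /\ u \notin T].
Proof.
move=> Z0Z V bg Istep Ic; have [k] := ubnP (count (fun w => w \notin Z) W).
elim: k Z c l Z0Z V bg Ic => // k IH Z c l Z0Z V bg Ic kW.
have [cT|] := pselect (forall i, c i \in T).
  by exists Z, c, l; split=> //; [exact: ext_refl | left].
move=> /existsNP[i /negP ciT].
have [|y e bg'] := one_step QTdec bg ciT (m0 := 0).
  by move=> [w Tw /conn_notr]; apply; right.
have {}bg' : big QT (lset (c i :: Z) `|` ~` lset W) (upd c i y).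
  apply: (big_mono QTdec) bg' => v [|Wv]; last by left; right.
  by rewrite /lset /= inE => /predU1P[->|vZ]; [right | left; left].
have /negP yn : ~ (y \in c i :: Z).
  by have := @big_notin _ _ _ _ _ i bg'; rewrite /upd eqxx => h yZ; apply: h; left.
have yj j : y != c j.
  have [->|ji] := eqVneq j i; first by apply: contraNneq yn => ->; rewrite mem_head.
  apply: contra_neq ji => yc; apply: (big_inj bg').
  by rewrite /upd eqxx; case: eqP.
move: yn; rewrite inE negb_or => /andP[yx yZ].
have ciZ : c i \notin Z by case: V.
have ciW : c i \in W.
  apply: contrapT => niW; apply: (@big_notin _ _ _ _ _ i bg); right; exact: niW.
have Iy : I y.
  apply: Istep (Ic i) ciT _ e _; [exact: contra (Z0Z _) ciZ | exact: contra (Z0Z _) yZ].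
have E := ext_step (G := I) V e yZ yj Iy.
have [|||||Z' [c' [l' [E' ZZ' cT' hZ']]]] := IH (c i :: Z) (upd c i y) (push c l i).
- by move=> x /Z0Z xZ; rewrite inE xZ orbT.
- by case: E.
- exact: bg'.
- by move=> j; rewrite /upd; case: ifP.
- rewrite -ltnS; apply: leq_trans kW; rewrite ltnS; apply: (count_ltn (x := c i)) => //.
    by move=> x; rewrite inE negb_or => /andP[].
  by rewrite inE eqxx.
exists Z', c', l'; split=> //; first exact: ext_trans E E'.
  by move=> x xZ; apply: ZZ'; rewrite inE xZ orbT.
move=> u /hZ'[|]; last by right.
by rewrite inE => /predU1P[->|]; [right | left].
Qed.
End Finite.
End Tokens.

(** * Absorbing prescribed vertices *)

Section Absorb.
Variables (D : digraph) (n : nat) (Q : nat -> set D).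
Hypothesis Qdec : forall m n, m <= n -> Q n `<=` Q m.
Variables (S : seq D) (G : set D).
Hypothesis Gstep : forall u v, G u -> u \notin S -> edge u v -> v \notin S -> G v.
Hypothesis nonfan : forall x, G x ->
  exists B : seq D, x \notin B /\ exists m, ~ rch Q (lset S `|` lset B) x m.
Implicit Types (Z : seq D) (c : 'I_n -> D) (l : 'I_n -> seq D).

Definition state Z c l : Prop :=
  [/\ valid Z c l, {subset S <= Z}, big Q (lset Z) c & forall i, G (c i)].

Definition better Z c l Z' c' l' : Prop :=
  [/\ state Z' c' l', ext G c l Z' c' l' & {subset Z <= Z'}].

Lemma better_trans Z1 c1 l1 Z2 c2 l2 Z3 c3 l3 :
  better Z1 c1 l1 Z2 c2 l2 -> better Z2 c2 l2 Z3 c3 l3 -> better Z1 c1 l1 Z3 c3 l3.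
Proof.
move=> [s2 e2 z2] [s3 e3 z3]; split=> //; first exact: ext_trans e2 e3.
by move=> x /z2/z3.
Qed.

(** The blocking set required by [one_step] comes from [nonfan]. *)
Lemma advance Z c l i : state Z c l ->
  exists Z' c' l', better Z c l Z' c' l' /\ c i \in Z'.
Proof.
move=> [V SZ bg Gc]; have [B [ciB [m nB]]] := nonfan (Gc i).
have [|y e bg'] := one_step Qdec bg ciB (m0 := m).
  move=> r; apply: nB; apply: (rch_mono Qdec _ (leqnn m)) r.
  by move=> x [xS|]; [left; exact: SZ | right].
have {}bg' : big Q (lset (c i :: Z)) (upd c i y).
  apply: (big_mono Qdec) bg' => v.
  by rewrite /lset /= inE => /predU1P[->|vZ]; [right | left].
have /negP yn : ~ (y \in c i :: Z).
  by have := @big_notin _ _ _ _ _ i bg'; rewrite /upd eqxx.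
have yj j : y != c j.
  have [->|ji] := eqVneq j i; first by apply: contraNneq yn => ->; rewrite mem_head.
  apply: contra_neq ji => yc; apply: (big_inj bg').
  by rewrite /upd eqxx; case: eqP.
move: (yn); rewrite inE negb_or => /andP[yx yZ].
have ciZ : c i \notin Z by case: V.
have Gy : G y.
  by apply: Gstep (Gc i) _ e _; [exact: contra (SZ _) ciZ | exact: contra (SZ _) yZ].
have E := ext_step V e yZ yj Gy.
exists (c i :: Z), (upd c i y), (push c l i); split; last exact: mem_head.
split=> //; last by move=> x xZ; rewrite inE xZ orbT.
split=> //; first by case: E.
  by move=> x /SZ xZ; rewrite inE xZ orbT.
by move=> j; rewrite /upd; case: ifP.
Qed.

(** Far walks from the points pass through [X], so the points are also big towards [X] and can be
    linked into it. Their [n] distinct new positions fill [X]. *)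
Lemma move_to_cut Z c l (X : seq D) : state Z c l -> size X <= n ->
  (forall i, cut Q (lset Z `|` lset X) (c i)) ->
  exists Z' c' l', better Z c l Z' c' l' /\ forall x, x \in X -> exists i, c' i = x.
Proof.
move=> [V SZ bg Gc] sX cX.
have bgX : big (fun=> lset X) (lset Z) c.
  move=> Y /bg[i ni]; exists i => -[k h]; apply: h.
  have [m nm] := cX i; have [w Qw cw] := not_cut ni m.
  have [cw'|[v [Xv cv _]]] := conn_meet (lset X) cw; last by exists v.
  by case: nm; exists w => //; apply: conn_mono cw' => v [Zv|Xv]; [left; left | right].
have [W bgW] := big_finite bgX.
(* New vertices are kept on the side that [X] cuts off, so that the paths use nothing beyond [X]. *)
pose I v := G v /\ cut Q (lset Z `|` lset X) v.
have [||Z' [c' [l' [E ZZ' cT' hZ']]]] :=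
  @link_into D n X Z Z W c l I (fun _ h => h) V bgW.
- move=> u v [Gu cu] uX uZ e vZ; split.
    by apply: Gstep Gu _ e _; [exact: contra (SZ _) uZ | exact: contra (SZ _) vZ].
  by apply: cut_edge e cu => -[h|h]; [move/negP: uZ | move/negP: uX]; apply.
- by move=> i; split.
have [V' H] := E; exists Z', c', l'.
have inj : injective c'.
  move=> i j ij; have [_ _ _ _ vd] := V'.
  by apply: (vd _ _ (c' i)); rewrite ?ij mem_head.
have Xc x : x \in X -> exists i, c' i = x.
  move=> xX; suff : x \in codom c' by move=> /codomP[i ->]; exists i.
  have sub : {subset codom c' <= X} by move=> _ /codomP[i ->].
  have uc : uniq (codom c') by rewrite map_inj_uniq// enum_uniq.
  have [|_ ->//] := uniq_min_size uc sub.
  by rewrite size_codom card_ord.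
split=> //; split.
- split=> //; first by move=> x /SZ/ZZ'.
    (* Bigness survives: a far walk from an old point off [Y] leaves [X] last at some [c' j], and
       afterwards meets no new vertex of [Z'], as those are cut off by [X]. So [Y] does not cut off
       [c' j]. *)
    move=> Y sY; apply: contrapT => all.
    have {}all i : cut Q (lset Z' `|` lset Y) (c' i).
      by apply: contrapT => h; apply: all; exists i.
    have [m1 h1] := cut_uniform Qdec (codom c') (fun _ => lset Z' `|` lset Y).
    have [m2 h2] := cut_uniform Qdec (Z' ++ codom c) (fun _ => lset Z `|` lset X).
    have [i /not_cut r] := bg Y sY.
    have [w Qw cw] := r (maxn m1 m2).
    have [cw'|[v [q [Xv cv pq lq [hq qX]]]]] := conn_last (lset X) cw.
      apply: (h2 (c i)); [by rewrite mem_cat codom_f orbT | exact: cX |].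
      exists w; first exact: Qdec (leq_maxr _ _) _ Qw.
      by apply: conn_mono cw' => v [Zv|Xv]; [left; left | right].
    have [j cj] := Xc v Xv; apply: (h1 (c' j)); rewrite ?codom_f//.
    exists w; first exact: Qdec (leq_maxl _ _) _ Qw.
    rewrite cj; exists q; split=> // u uq [uZ'|Yu]; last by apply: (hq u uq); right.
    move: uq uZ'; rewrite inE => /predU1P[->|uq].
      by rewrite -cj /lset /=; apply/negP; have [_ _ ->] := V'.
    move=> uZ'; have [uZ|[[_ cu] _]] := hZ' _ uZ'.
      by apply: (hq u); [rewrite inE uq orbT | left].
    apply: (h2 u); rewrite ?mem_cat ?uZ'//.
    exists w; first exact: Qdec (leq_maxr _ _) _ Qw.
    case: q pq lq hq qX uq => // a q /= /andP[e pa] la hq qX uq.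
    rewrite -la; apply: path_conn_suffix => // z zq [Zz|zX]; last exact: qX zX.
    by apply: (hq z); [rewrite inE zq orbT | left].
  move=> i; have [[|a p] e pI] := H i; first by case: e => ->.
  by case: e => ->; have [] := pI a (mem_head _ _).
- by apply: ext_mono E => v [].
- exact: ZZ'.
Qed.

(* A vertex [w] whose removal admits a cut [Y] by fewer than [n] vertices lies on the cut
   [w :: Y], to which the paths can be moved; then [w] is an end vertex of a path. *)
Lemma absorb Z c l w : state Z c l -> exists Z' c' l', better Z c l Z' c' l' /\ w \in Z'.
Proof.
move=> st; have [[i <-]|nw] := pselect (exists i, c i = w); first exact: advance.
have [V SZ bg Gc] := st.
have [bgw|] := pselect (big Q (lset (w :: Z)) c).
  have V' : valid (w :: Z) c l.
    by apply: valid_cons => // i; apply/eqP => ciw; apply: nw; exists i.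
  exists (w :: Z), c, l; split; last exact: mem_head.
  split; first split=> //; first by move=> x /SZ xZ; rewrite inE xZ orbT.
    exact: ext_refl.
  by move=> x xZ; rewrite inE xZ orbT.
move=> /existsNP[Y /not_implyP[sY /forallNP cY]].
have [|i|Z1 [c1 [l1 [b1 h1]]]] := @move_to_cut Z c l (w :: Y) st.
- exact: sY.
- apply: (cut_mono Qdec) (contrapT (cY i)) => x.
  rewrite /setU /lset /= !inE => -[/orP[/eqP->|xZ]|xY]; [|by left|]; right.
    by rewrite eqxx.
  by rewrite xY orbT.
have [i <-] := h1 w (mem_head _ _); have [st1 _ _] := b1.
have [Z2 [c2 [l2 [b2 h2]]]] := advance i st1.
by exists Z2, c2, l2; split=> //; exact: better_trans b1 b2.
Qed.

Lemma better_refl Z c l : state Z c l -> better Z c l Z c l.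
Proof. by move=> s; split=> //; apply: ext_refl; case: s. Qed.

Lemma absorb_all Z c l (L : seq D) : state Z c l ->
  exists Z' c' l', better Z c l Z' c' l' /\ {subset L <= Z'}.
Proof.
elim: L => [|w L IH] st; first by exists Z, c, l; split=> //; exact: better_refl.
have [Z1 [c1 [l1 [b1 h1]]]] := IH st; have [st1 _ _] := b1.
have [Z2 [c2 [l2 [b2 h2]]]] := absorb w st1.
exists Z2, c2, l2; split; first exact: better_trans b1 b2.
by have [_ _ z2] := b2; move=> x; rewrite inE => /predU1P[->//|/h1/z2].
Qed.

(** By bigness each [c i] reaches [Q k] off [Z]. Absorbing these walks into [Z'] makes the walks of
    later rounds disjoint from them. *)
Lemma big_round Z c l k : state Z c l ->
  exists Z' c' l', better Z c l Z' c' l' /\ forall i,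
    exists L, [/\ path (@edge D) (c i) L, Q k (last (c i) L),
      forall x, x \in c i :: L -> x \notin Z & {subset c i :: L <= Z'}].
Proof.
move=> st; have [V SZ bg Gc] := st.
have paths i : exists L, [/\ path (@edge D) (c i) L, Q k (last (c i) L)
      & forall x, x \in c i :: L -> x \notin Z].
  have [j nj] := bg _ (size_others_lt c i).
  have ji : j = i.
    apply: contrapT => /eqP ji; apply: nj; apply: cut_in; right; exact: mem_others.
  have [w Qw [L [pL lL hL]]] := not_cut nj k; rewrite ji in pL lL hL.
  exists L; split=> //; first by rewrite lL.
  by move=> x /hL h; apply/negP => xZ; apply: h; left.
have [f hf] := choice paths.
have [Z' [c' [l' [b h]]]] := absorb_all (flatten [seq c i :: f i | i <- enum 'I_n]) st.
exists Z', c', l'; split=> // i; have [pf Qf nf] := hf i.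
exists (f i); split=> // x xf; apply: h; apply/flattenP; exists (c i :: f i) => //.
by apply: map_f; rewrite mem_enum.
Qed.
End Absorb.

Definition ray_seq (D : digraph) (r : nat -> D) : Prop :=
  injective r /\ forall t, edge (r t) (r t.+1).

(** * Rays as limits of growing paths *)

Section Limit.
Variables (D : digraph) (n : nat) (Q : nat -> set D) (G : set D).
Hypothesis Qdec : forall m n, m <= n -> Q n `<=` Q m.
Variable Inv : seq D -> ('I_n -> D) -> ('I_n -> seq D) -> Prop.

(** One round of the construction. It is abstract in [Inv] because it serves both for paths ending
    in big points and for paths ending in vertices with infinite fans. *)
Definition grows (k : nat) (Z : seq D) (c : 'I_n -> D) (l : 'I_n -> seq D)
    (Z' : seq D) (c' : 'I_n -> D) (l' : 'I_n -> seq D) : Prop :=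
  [/\ Inv Z' c' l', ext G c l Z' c' l', {subset Z <= Z'} & forall i,
    exists L, [/\ path (@edge D) (c i) L, Q k (last (c i) L),
      forall x, x \in c i :: L -> x \notin Z & {subset c i :: L <= Z'}]].

Hypothesis next : forall Z c l k, Inv Z c l -> exists Z' c' l', grows k Z c l Z' c' l'.

(* The paths [L] of the successive rounds starting on one ray are pairwise disjoint. *)
Lemma limit_rays Z0 c0 : Inv Z0 c0 (fun=> [::]) -> valid Z0 c0 (fun=> [::]) ->
  (forall i, G (c0 i)) ->
  exists r : 'I_n -> nat -> D, [/\ forall i, ray_seq (r i), forall i t, G (r i t),
    forall i j s t, r i s = r j t -> i = j
    & forall i (F : seq D), exists t, exists2 w, Q 0 w & conn (lset F) (r i t) w].
Proof.
move=> I0 V0 G0.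
pose T := (seq D * (('I_n -> D) * ('I_n -> seq D)))%type.
have [|nx hnx] := @choice (nat * T) T (fun x y => Inv x.2.1 x.2.2.1 x.2.2.2 ->
    grows x.1 x.2.1 x.2.2.1 x.2.2.2 y.1 y.2.1 y.2.2).
  move=> [k [Z [c l]]] /=; have [I|nI] := pselect (Inv Z c l); last by exists (Z, (c, l)).
  by have [Z' [c' [l' g]]] := next k I; exists (Z', (c', l')).
pose st := fix st k : T := if k is k'.+1 then nx (k', st k') else (Z0, (c0, fun=> [::])).
pose Z k := (st k).1; pose c k := (st k).2.1; pose l k := (st k).2.2.
have Ik k : Inv (Z k) (c k) (l k).
  by elim: k => // k IH; have [] := hnx (k, st k) IH.
have gk k : grows k (Z k) (c k) (l k) (Z k.+1) (c k.+1) (l k.+1) := hnx (k, st k) (Ik k).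
have Vk k : valid (Z k) (c k) (l k) by case: k => // k; have [_ []] := gk k.
have ZZ j k x : j <= k -> x \in Z j -> x \in Z k.
  move=> /subnK <-; elim: (k - j) => // d IH /IH; rewrite addSn.
  by have [_ _ h _] := gk (d + j); exact: h.
pose h i k := rev (c k i :: l k i).
(* The growth is strict: [L] starts at the old end vertex, which thus lies in the new [Z] and is no
   end vertex any more. *)
have hS i k : exists2 q, h i k.+1 = h i k ++ q & q <> [::] /\ forall x, x \in q -> G x.
  have [_ [[_ _ cZ _ _] hext] _ hL] := gk k.
  have [p e pG] := hext i; exists (rev p); first by rewrite /h e rev_cat.
  split; last by move=> x; rewrite mem_rev; exact: pG.
  case: p e {pG} => [[e _] _|a p _]; last by rewrite rev_cons; case: (rev p).
  have [L [_ _ _ LZ]] := hL i; have := cZ i.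
  by rewrite e (LZ (c k i)) ?mem_head.
have sz i k : k < size (h i k).
  elim: k => [|k IH]; first by rewrite size_rev.
  have [q -> [q0 _]] := hS i k; rewrite size_cat; case: q q0 => //= a q _.
  by rewrite addnS ltnS; exact: leq_trans IH (leq_addr _ _).
have pre i j k : j <= k -> exists q, h i k = h i j ++ q.
  move=> /subnK <-; elim: (k - j) => [|d [q e]]; first by exists [::]; rewrite cats0.
  by have [q' e' _] := hS i (d + j); exists (q ++ q'); rewrite addSn e' e catA.
(* The list [h i t] has more than [t] entries and later lists extend it, so the default value never
   occurs. *)
pose r i t := nth (c0 i) (h i t) t.
have nthE i k t : t < size (h i k) -> nth (c0 i) (h i k) t = r i t.
  move=> tk; have [kt|tk'] := leqP k t.
    by have [q e] := pre i k t kt; rewrite /r e nth_cat tk.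
  by have [q ->] := pre i t k (ltnW tk'); rewrite nth_cat sz.
have hk i k t : t <= k -> r i t \in h i k.
  by move=> tk; rewrite -(nthE i k); [apply: mem_nth|]; exact: leq_ltn_trans tk (sz i k).
exists r; split.
- move=> i; split.
    move=> s t; pose k := maxn s t.
    have sk : s < size (h i k) := leq_ltn_trans (leq_maxl _ _) (sz i k).
    have tk : t < size (h i k) := leq_ltn_trans (leq_maxr _ _) (sz i k).
    rewrite -(nthE _ _ _ sk) -(nthE _ _ _ tk) => /eqP; rewrite nth_uniq//; first by move/eqP.
    by rewrite rev_uniq; case: (Vk k).
  move=> t; rewrite -(nthE i t.+1); last exact: ltnW (sz _ _).
  rewrite -(nthE i t.+1); last exact: sz.
  have [vp _ _ _ _] := Vk t.+1.
  by apply/sortedP; [rewrite rev_sorted; exact: vp | exact: sz].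
- have hG i k x : x \in h i k -> G x.
    elim: k => [|k IH]; first by rewrite mem_rev inE => /eqP->.
    have [q -> [_ qG]] := hS i k; rewrite mem_cat => /orP[/IH//|/qG//].
  by move=> i t; apply: hG (hk _ _ _ (leqnn t)).
- move=> i j s t e; pose k := maxn s t; have [_ _ _ _ vd] := Vk k.
  apply: (vd _ _ (r i s)); rewrite -mem_rev; first exact/hk/leq_maxl.
  by rewrite e; exact/hk/leq_maxr.
- move=> i F; have [|L hL] := @choice nat (seq D) (fun k L =>
      [/\ path (@edge D) (c k i) L, Q k (last (c k i) L),
      forall x, x \in c k i :: L -> x \notin Z k & {subset c k i :: L <= Z k.+1}]).
    by move=> k; have [_ _ _] := gk k; apply.
  have [m hm] : exists m, forall x, x \in F -> forall k, m <= k -> x \notin c k i :: L k.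
    apply: (@uniform_bound _ (fun x m => forall k, m <= k -> x \notin c k i :: L k)).
      by move=> x p q pq hx k qk; apply: hx; exact: leq_trans qk.
    move=> x _; have [[p xp]|no] := pselect (exists p, x \in c p i :: L p); last first.
      by exists 0 => k _; apply/negP => xk; apply: no; exists k.
    exists p.+1 => k pk; apply/negP => xk; have [_ _ nk _] := hL k.
    by have /negP := nk x xk; apply; apply: (ZZ p.+1) => //; have [_ _ _] := hL p; apply.
  have [pL qL _ _] := hL m.
  have rc : r i (size (l m i)) = c m i.
    by rewrite -(nthE i m) /h ?nth_rev ?size_rev ?ltnSn//= subnn.
  exists (size (l m i)), (last (c m i) (L m)); first exact: Qdec qL.
  rewrite rc; exists (L m); split=> // x xL xF.
  by have := hm x xF m (leqnn m); rewrite xL.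
Qed.
End Limit.

(** * Rays and anti-rays as sequences *)

Section Raylike.
Variables (T : Type) (V : set T) (a : T -> T -> Prop).

(** Stated for an abstract arc relation, so that it also covers anti-rays, with their arcs
    reversed. *)
Definition raylike (x : T) : Prop :=
  [/\ forall u v, V u -> V v -> Relation_Operators.clos_refl_sym_trans T a u v, V x,
      ([set u | a u x] #= `I_0)%card, ([set w | a x w] #= `I_1)%card
    & forall v, V v -> v <> x ->
        ([set u | a u v] #= `I_1)%card /\ ([set w | a v w] #= `I_1)%card].

Lemma card_I1P (B : set T) : (B #= `I_1)%card -> exists y, B = [set y].
Proof.
move=> /eq_cardSP[y By]; rewrite II0 card_eq0 => /eqP e; exists y.
apply/seteqP; split=> z; last by move=> ->.
by move=> Bz; apply: contrapT => zy; have : (set0 : set T) z by rewrite -e.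
Qed.

Hypothesis aV : forall u v, a u v -> V u /\ V v.

(** The sequence iterates the unique out-neighbour. It is injective because in-neighbours are unique
    and [x] has none; it exhausts [V] because lying on it is preserved along arcs in both
    directions. *)
Lemma raylike_seq x : raylike x -> exists r : nat -> T,
  [/\ injective r, r 0 = x, V = range r, forall t, a (r t) (r t.+1)
    & forall u v, a u v -> exists2 t, u = r t & v = r t.+1].
Proof.
move=> [conn Vx in0 out0 deg].
have out v : V v -> exists w, forall w', a v w' <-> w' = w.
  move=> Vv; have [->|vx] := pselect (v = x).
    by have [w e] := card_I1P out0; exists w => w'; have -> : a x w' = [set w] w' by rewrite -e.
  have [w e] := card_I1P (deg v Vv vx).2.
  by exists w => w'; have -> : a v w' = [set w] w' by rewrite -e.
have inn v u u' : V v -> a u v -> a u' v -> u = u'.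
  move=> Vv auv au'v; have vx : v <> x.
    move=> vx; move: in0; rewrite II0 card_eq0 => /eqP e.
    by have : (set0 : set T) u by rewrite -e /= -vx.
  have [w e] := card_I1P (deg v Vv vx).1.
  have hw t : a t v -> t = w by move=> atv; have : [set w] t by rewrite -e.
  by rewrite (hw _ auv) (hw _ au'v).
have in0' u : ~ a u x.
  by move: in0; rewrite II0 card_eq0 => /eqP e au; have : (set0 : set T) u by rewrite -e.
have [|f hf] := @choice T T (fun v w => V v -> forall w', a v w' <-> w' = w).
  move=> v; have [Vv|nV] := pselect (V v); last by exists v.
  by have [w h] := out v Vv; exists w.
pose r t := iter t f x.
have Vr t : V (r t).
  elim: t => //= t IH; have /(_ (f (r t))) h := hf _ IH.
  by have [|_ Vf] := @aV (r t) (f (r t)); [apply/h|].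
have ar t : a (r t) (r t.+1) by have /(_ (f (r t))) h := hf _ (Vr t); apply/h.
have lt s t : s < t -> r s <> r t.
  elim: s t => [|s IH] [|t] // st e; first by apply: (in0' (r t)); rewrite -[x]/(r 0) e.
  by apply: (IH t st); apply: (inn (r s.+1)) => //; rewrite e.
have inj : injective r.
  by move=> s t e; case: (ltngtP s t) => // [/lt|/lt]; rewrite e.
have step u v : a u v -> (exists t, u = r t) <-> (exists t, v = r t).
  move=> auv; split=> -[t e].
    exists t.+1; have /(_ v) h := hf _ (Vr t); rewrite /r /= -/(r t).
    by apply/h; rewrite -e.
  case: t e => [e|t e]; first by case: (in0' u); rewrite -[x]/(r 0) -e.
  by exists t; apply: (inn v) => //; rewrite e.
have VE : V = range r.
  apply/seteqP; split=> [v Vv|_ [t _ <-]]; last exact: Vr.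
  suff [t ->] : exists t, v = r t by exists t.
  suff : (exists t, x = r t) <-> (exists t, v = r t) by move=> [h _]; apply: h; exists 0.
  elim: (conn x v Vx Vv) => [u w /step//|u//|u w _ []//|u w z _ [h1 h2] _ [h3 h4]].
  by split=> [/h1/h3|/h4/h2].
exists r; split=> // u v auv; have [Vu _] := aV auv.
move: Vu; rewrite VE => -[t _ e]; exists t => //.
by have /(_ v) h := hf _ (Vr t); rewrite /r /= -/(r t); apply/h; rewrite e.
Qed.

End Raylike.

Lemma seq_raylike (T : Type) (r : nat -> T) : injective r ->
  raylike (range r) (fun u v => exists2 t, u = r t & v = r t.+1) (r 0).
Proof.
move=> inj; set a := fun _ _ => _.
have c t : Relation_Operators.clos_refl_sym_trans T a (r 0) (r t).
  elim: t => [|t IH]; first exact: Relation_Operators.rst_refl.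
  apply: Relation_Operators.rst_trans IH _; apply: Relation_Operators.rst_step.
  by exists t.
have out t : [set w | a (r t) w] = [set r t.+1].
  by apply/seteqP; split=> [w [s /inj-> ->]|w ->] //; exists t.
have inn t : [set u | a u (r t.+1)] = [set r t].
  by apply/seteqP; split=> [u [s -> /inj[->]]|u ->] //; exists t.
split.
- move=> _ _ [s _ <-] [t _ <-]; apply: Relation_Operators.rst_trans (c t).
  exact: Relation_Operators.rst_sym.
- by exists 0.
- rewrite II0 card_eq0; apply/eqP/seteqP; split=> // u [t _ /inj].
  by [].
- by rewrite out card_set1.
- move=> _ [[|t] _ <-] // _; rewrite out inn; split; exact: card_set1.
Qed.

(** * Infinite disjoint families *)

Section Selection.
Variable D : digraph.
Implicit Types (A B X : set D) (F s : seq D).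

(** Each element of [F] excludes at most one member of [P]. *)
Lemma infinite_avoid (P : set (seq D)) (hit : D -> seq D -> Prop) F :
  infinite_set P ->
  (forall f s t, f \in F -> P s -> P t -> hit f s -> hit f t -> s = t) ->
  exists2 s, P s & forall f, f \in F -> ~ hit f s.
Proof.
move=> infP inj; apply: contrapT => none; apply: infP.
have hits s : P s -> exists2 f, f \in F & hit f s.
  move=> Ps; apply: contrapT => h; apply: none; exists s => // f Ff hf.
  by apply: h; exists f.
pose g f := xget [::] [set s | P s /\ hit f s].
apply: (@sub_finite_set _ _ (g @` [set` F])); last exact/finite_image/finite_seq.
move=> s Ps; have [f Ff hf] := hits s Ps; exists f => //.
rewrite /g; case: xgetP => [t _ [Pt ht]|/(_ s)]; first exact: (inj f).
by case.
Qed.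

(** [core] is the part required to be disjoint: the whole dipath, or for a fan the dipath without
    its centre. Nonempty cores make the chosen members distinct. *)
Lemma greedy_family (P : set (seq D)) (core : seq D -> seq D) :
  (forall F, exists2 s, P s & core s <> [::] /\ forall x, x \in core s -> x \notin F) ->
  exists S : set (seq D), [/\ infinite_set S, S `<=` P
    & forall s t x, S s -> S t -> x \in core s -> x \in core t -> s = t].
Proof.
move=> h; have [|f hf] := @choice (seq D) (seq D) (fun F s =>
  P s /\ core s <> [::] /\ forall x, x \in core s -> x \notin F).
  by move=> F; have [s] := h F; exists s.
pose F := fix F k := if k is k'.+1 then core (f (F k')) ++ F k' else [::].
have mono j k x : j <= k -> x \in F j -> x \in F k.
  move=> /subnK <-; elim: (k - j) => // d IH /IH xF.
  by rewrite addSn /= mem_cat xF orbT.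
have lt j k x : j < k -> x \in core (f (F j)) -> x \notin core (f (F k)).
  move=> jk xj; apply/negP => xk; have [_ [_ /(_ _ xk)/negP]] := hf (F k); apply.
  by apply: mono jk _; rewrite /= mem_cat xj.
have eqk j k x : x \in core (f (F j)) -> x \in core (f (F k)) -> j = k.
  move=> xj xk; case: (ltngtP j k) => // [/lt/(_ xj)|/lt/(_ xk)]; first by rewrite xk.
  by rewrite xj.
exists (range (fun k => f (F k))); split.
- rewrite (eq_finite_set (inj_card_eq _)); first exact: infinite_nat.
  move=> j k _ _ e; have [_ [c0 _]] := hf (F j).
  case E: (core (f (F j))) c0 => [//|x p] _.
  by apply: (eqk _ _ x); rewrite -?e E mem_head.
- by move=> _ [k _ <-]; have [] := hf (F k).
- by move=> _ _ x [j _ <-] [k _ <-] xj xk; rewrite (eqk _ _ _ xj xk).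
Qed.
End Selection.

(** * Linked sets and rays as sequences *)

Section Lines.
Variable D : digraph.
Implicit Types (A B X : set D) (F : seq D) (r : nat -> D) (H Q R : subdigraph D).

(** A shortest walk off [X] from [A] to [B] has no inner vertex in either set. *)
Lemma dipath_of_conn X A B u v : A u -> B v -> conn X u v ->
  exists2 s, dipath A B s & forall y, y \in s -> ~ X y.
Proof.
move=> Au Bv c.
pose P k := exists x p, [/\ size p = k, path (@edge D) x p, A x /\ B (last x p)
  & forall y, y \in x :: p -> ~ X y].
have [|k [x [p0 [sk px [Ax Bx] Xp]]] kmin] := @ex_minimal_nat P.
  by have [p [pu lu h]] := c; exists (size p), u, p; rewrite lu.
move: Bx; have [p pxp up sub] := shortenP px => Bx.
have {Xp}offX y : y \in x :: p -> ~ X y.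
  by rewrite inE => yp; apply: Xp; rewrite inE; case/orP: yp => [->//|/sub->]; rewrite orbT.
have {sub}sz : size p <= k.
  by rewrite -sk; apply: uniq_leq_size sub; case/andP: up.
exists (x :: p) => //; split=> // v' v'p v'x v'l.
have {v'p v'x}v'p : v' \in p by move: v'p; rewrite inE (negPf v'x).
move: (v'p); case/splitPr: v'p pxp up Bx offX sz v'l => p1 p2.
rewrite cat_path last_cat size_cat /= addnS => /and3P[pp1 e pp2] up Bx offX sz v'l _ [Av|Bv'].
  suff kp : k <= size p2 by have := leq_trans sz kp; rewrite ltnNge leq_addl.
  apply: kmin; exists v', p2; split=> // y yp; apply: offX.
  by rewrite inE mem_cat yp !orbT.
have p2n : 0 < size p2 by move: v'l; case: (p2); rewrite //= eqxx.
suff kp : k <= (size p1).+1.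
  by have := leq_trans sz kp; rewrite ltnS -[leqRHS]addn0 leq_add2l leqNgt p2n.
rewrite -(size_rcons p1 v'); apply: kmin; exists x, (rcons p1 v'); split=> //.
- by rewrite rcons_path pp1.
- by rewrite last_rcons.
- move=> y; rewrite inE mem_rcons inE => h; apply: offX; rewrite inE mem_cat inE.
  by case/or3P: h => ->; rewrite ?orbT.
Qed.

Lemma dipath_conn X A B s : dipath A B s -> (forall x, x \in s -> ~ X x) ->
  exists u v, [/\ A u, B v & conn X u v].
Proof.
case: s => // x p [pp _ Ax Bl _] off; exists x, (last x p); split=> //.
by exists p.
Qed.

(** The finite-deletion form of having infinitely many disjoint dipaths from [A] to [B]. *)
Definition linked A B : Prop := forall F, exists u v, [/\ A u, B v & conn (lset F) u v].

Lemma line_leE Q R : line_le Q R <-> linked (verts Q) (verts R).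
Proof.
split=> [[P [infP PQR triv]] F|h].
  have [|s Ps off] := @infinite_avoid D P (fun f s => f \in s) F infP.
    move=> f s t _ Ps Pt fs ft; apply: triv Ps Pt _.
    by exists f.
  by apply: (dipath_conn (PQR s Ps)) => x xs xF; apply: off xs.
have [F|S [infS SP inj]] := @greedy_family D (dipath (verts Q) (verts R)) id.
  have [u [v [Qu Rv c]]] := h F; have [s ds off] := dipath_of_conn Qu Rv c.
  exists s => //; split; first by case: s ds {off}.
  by move=> x /off/negP.
exists S; split=> //.
by move=> s t Ss St [x [xs xt]]; exact: inj Ss St xs xt.
Qed.

Lemma linked_sub A A' B B' : A `<=` A' -> B `<=` B' -> linked A B -> linked A' B'.
Proof. by move=> AA BB h F; have [u [v [/AA Au /BB Bv c]]] := h F; exists u, v. Qed.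

Lemma conn_ray X r s t : (forall t, edge (r t) (r t.+1)) ->
  (forall t, s <= t -> ~ X (r t)) -> s <= t -> conn X (r s) (r t).
Proof.
move=> e off /subnKC <-; elim: (t - s) => [|d IH]; first by rewrite addn0; exact/conn_refl/off.
apply: conn_trans IH _; rewrite addnS; apply: conn_edge => //; apply: off; lia.
Qed.

Lemma conn_antiray X r s t : (forall t, edge (r t.+1) (r t)) ->
  (forall t, s <= t -> ~ X (r t)) -> s <= t -> conn X (r t) (r s).
Proof.
move=> e off /subnKC <-; elim: (t - s) => [|d IH]; first by rewrite addn0; exact/conn_refl/off.
apply: conn_trans IH; rewrite addnS; apply: conn_edge => //; apply: off; lia.
Qed.

Lemma eventually_off r F : injective r -> exists m, forall t, m <= t -> r t \notin F.
Proof.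
move=> inj.
have [m hm] : exists m, forall x, x \in F -> forall t, m <= t -> r t != x.
  apply: (@uniform_bound _ (fun x m => forall t, m <= t -> r t != x)).
    by move=> x p q pq h t qt; apply: h; exact: leq_trans qt.
  move=> x _; have [[p rp]|no] := pselect (exists p, r p = x); last first.
    by exists 0 => t _; apply/eqP => e; apply: no; exists t.
  by exists p.+1 => t pt; apply/eqP; rewrite -rp => /inj tp; rewrite tp ltnn in pt.
by exists m => t mt; apply/negP => tF; have := hm _ tF t mt; rewrite eqxx.
Qed.

Definition line_set A : Prop := exists2 r, injective r /\ A = range r &
  (forall t, edge (r t) (r t.+1)) \/ (forall t, edge (r t.+1) (r t)).

Definition init r m : seq D := [seq r t | t <- iota 0 m].

Lemma init_ge r m t : r t \notin init r m -> m <= t.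
Proof. by apply: contraNleq => tm; apply: map_f; rewrite mem_iota. Qed.

(** The walk joins [L] beyond [F] and follows it. On a ray the entry is chosen first and the exit
    further out; on an anti-ray the exit is chosen first. *)
Lemma linked_trans A L B : line_set L -> linked A L -> linked L B -> linked A B.
Proof.
move=> [r [inj ->] e] h1 h2 F; have [m hm] := eventually_off F inj.
have sub F1 F2 : lset F1 `<=` lset (F1 ++ F2).
  by move=> x; rewrite /lset /= mem_cat => ->.
have late G s : ~ lset (F ++ init r G) (r s) -> G <= s.
  move=> h; apply: (@init_ge r); apply/negP => k; apply: h.
  by rewrite /lset /= mem_cat k orbT.
case: e => e.
  have [u [_ [Au [s _ <-] c1]]] := h1 (F ++ init r m).
  have ms : m <= s := late _ _ (conn_notr c1).
  have [_ [v [[t _ <-] Bv c2]]] := h2 (F ++ init r s).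
  have st : s <= t := late _ _ (conn_notl c2).
  exists u, v; split=> //; apply: conn_trans (conn_mono (sub _ _) c1) _.
  apply: conn_trans _ (conn_mono (sub _ _) c2); apply: conn_ray => // k sk.
  by apply/negP/hm; exact: leq_trans sk.
have [_ [v [[s _ <-] Bv c2]]] := h2 (F ++ init r m).
have ms : m <= s := late _ _ (conn_notl c2).
have [u [_ [Au [t _ <-] c1]]] := h1 (F ++ init r s).
have st : s <= t := late _ _ (conn_notr c1).
exists u, v; split=> //; apply: conn_trans (conn_mono (sub _ _) c1) _.
apply: conn_trans _ (conn_mono (sub _ _) c2); apply: conn_antiray => // k sk.
by apply/negP/hm; exact: leq_trans sk.
Qed.

Lemma linked_refl A : line_set A -> linked A A.
Proof.
move=> [r [inj ->] _] F; have [m hm] := eventually_off F inj.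
by exists (r m), (r m); split; [exists m|exists m|exact/conn_refl/negP/hm].
Qed.

Lemma ray_from_seq H x : ray_from H x -> exists r, [/\ ray_seq r, r 0 = x, verts H = range r,
  forall t, arcs H (r t) (r t.+1)
  & forall u v, arcs H u v -> exists2 t, u = r t & v = r t.+1].
Proof.
move=> [h1 h2 h3 h4 h5].
have [||r [i1 i2 i3 i4 i5]] := @raylike_seq D (verts H) (arcs H) _ x.
- by move=> u v /arcsP[].
- by split=> // v Vv /eqP vx; exact: h5.
by exists r; split=> //; split=> // t; have [] := arcsP (i4 t).
Qed.

Lemma antiray_to_seq H x : antiray_to H x -> exists r, [/\ injective r,
  (forall t, edge (r t.+1) (r t)), r 0 = x, verts H = range r
  & forall t, arcs H (r t.+1) (r t)].
Proof.
move=> [h1 h2 h3 h4 h5].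
have [||r [i1 i2 i3 i4 i5]] := @raylike_seq D (verts H) (fun u v => arcs H v u) _ x.
- by move=> u v /arcsP[].
- split=> //; last by move=> v Vv /eqP vx; have [] := h5 v Vv vx.
  move=> u v Vu Vv; elim: (h1 u v Vu Vv) => [a b ab|a|a b _|a b c _ ab _ bc].
  + by apply: Relation_Operators.rst_sym; exact: Relation_Operators.rst_step.
  + exact: Relation_Operators.rst_refl.
  + exact: Relation_Operators.rst_sym.
  + exact: Relation_Operators.rst_trans ab bc.
by exists r; split=> // t; have [] := arcsP (i4 t).
Qed.

Lemma is_line_set H : is_line H -> line_set (verts H).
Proof.
move=> [[x /ray_from_seq[r [[ri re] _ E _ _]]]|[x /antiray_to_seq[r [ri re _ E _]]]].
  by exists r => //; left.
by exists r => //; right.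
Qed.

Fact seq_arcsP r (hr : ray_seq r) (u v : D) :
  (exists2 t, u = r t & v = r t.+1) -> [/\ edge u v, range r u & range r v].
Proof. by move=> [t -> ->]; split; [exact: hr.2 | exists t | exists t.+1]. Qed.

Definition seq_ray r (hr : ray_seq r) : subdigraph D := Subdigraph (seq_arcsP hr).

Lemma seq_ray_from r (hr : ray_seq r) : ray_from (seq_ray hr) (r 0).
Proof.
by have [h1 h2 h3 h4 h5] := seq_raylike hr.1; split=> // v Vv /eqP vx; exact: h5.
Qed.

Fact seq_antiarcsP r (hr : forall t, edge (r t.+1) (r t)) (u v : D) :
  (exists2 t, v = r t & u = r t.+1) -> [/\ edge u v, range r u & range r v].
Proof. by move=> [t -> ->]; split; [exact: hr | exists t.+1 | exists t]. Qed.

Definition seq_antiray r (hr : forall t, edge (r t.+1) (r t)) : subdigraph D :=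
  Subdigraph (seq_antiarcsP hr).

Lemma seq_antiray_to r (inj : injective r) (hr : forall t, edge (r t.+1) (r t)) :
  antiray_to (seq_antiray hr) (r 0).
Proof.
have [h1 h2 h3 h4 h5] := seq_raylike inj; split=> //; last first.
  by move=> v Vv /eqP vx; have [] := h5 v Vv vx.
move=> u v Vu Vv; elim: (h1 u v Vu Vv) => [a b ab|a|a b _|a b c _ ab _ bc].
+ by apply: Relation_Operators.rst_sym; exact: Relation_Operators.rst_step.
+ exact: Relation_Operators.rst_refl.
+ exact: Relation_Operators.rst_sym.
+ exact: Relation_Operators.rst_trans ab bc.
Qed.

Lemma ray_shift r m : ray_seq r -> ray_seq (fun t => r (m + t)).
Proof.
by move=> [ri re]; split=> [s t /ri /addnI//|t]; rewrite addnS; exact: re.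
Qed.

(** A shortest walk off [X] from [u] to any vertex of [r] meets [r] only at its end, so [r] can be
    followed from there. *)
Lemma ray_prepend X r u s0 : ray_seq r -> (forall t, ~ X (r t)) -> conn X u (r s0) ->
  exists h, [/\ ray_seq h, h 0 = u, forall t, ~ X (h t)
    & exists a b, forall t, h (a + t) = r (b + t)].
Proof.
move=> [ri re] offr c.
pose P k := exists p b, [/\ size p = k, path (@edge D) u p, last u p = r b
  & forall y, y \in u :: p -> ~ X y].
have [|k [p0 [b [sk pu lu Xp]]] kmin] := @ex_minimal_nat P.
  by have [p [pu lu h]] := c; exists (size p), p, s0.
move: lu; have [p pp up sub] := shortenP pu => lu.
have {Xp}offX y : y \in u :: p -> ~ X y.
  by rewrite inE => yp; apply: Xp; rewrite inE; case/orP: yp => [->//|/sub->]; rewrite orbT.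
have {sub}sz : size p <= k.
  by rewrite -sk; apply: uniq_leq_size sub; case/andP: up.
have only j t : j < size p -> nth u (u :: p) j <> r t.
  move=> jp ej; have : k <= j; last by rewrite leqNgt (leq_trans jp sz).
  apply: kmin; exists (take j p), t; split.
  - by rewrite size_takel// ltnW.
  - by move: pp; rewrite -{1}[p](cat_take_drop j) cat_path => /andP[].
  - rewrite -ej (last_nth u) size_takel; last exact: ltnW.
    by rewrite -[u :: take j p]/(take j.+1 (u :: p)) nth_take.
  - move=> z; rewrite inE => zt; apply: offX; rewrite inE.
    by case/orP: zt => [->//|/mem_take->]; rewrite orbT.
pose a := size p.
pose h t := if t < a then nth u (u :: p) t else r (b + (t - a)).
have ha t : h (a + t) = r (b + t) by rewrite /h ltnNge leq_addr /= addKn.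
have hlt t : t <= a -> h t = nth u (u :: p) t.
  rewrite /h leq_eqVlt => /orP[/eqP->|->//].
  by rewrite ltnn subnn addn0 -lu (last_nth u).
exists h; split.
- split; last first.
    move=> t; case: (ltnP t a) => ta.
      rewrite !hlt ?(ltnW ta)//=; have /(pathP u) := pp; exact.
    by rewrite -(subnKC ta) -addnS !ha addnS; exact: re.
  have inj1 s t : s < a -> a <= t -> h s <> h t.
    by move=> sa ta; rewrite -(subnKC ta) ha hlt ?(ltnW sa)//; exact: only.
  move=> s t; case: (ltnP s a) (ltnP t a) => sa [] ta e.
  - move: e; rewrite !hlt ?(ltnW sa) ?(ltnW ta)// => /eqP.
    by rewrite nth_uniq//= ?ltnS ?(ltnW sa) ?(ltnW ta)// => /eqP.
  - by case: (inj1 s t sa ta).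
  - by case: (inj1 t s ta sa).
  - move: e; rewrite -(subnKC sa) -(subnKC ta) !ha => /ri /addnI -> //.
- by rewrite hlt.
- move=> t; case: (leqP t a) => ta; last by rewrite -(subnKC (ltnW ta)) ha.
  by rewrite hlt//; apply: offX; apply: mem_nth; rewrite ltnS.
- by exists a, b.
Qed.
End Lines.

(** * Ends *)

Section EndFacts.
Variables (K : realType) (D : digraph).
Implicit Types (H Q R T : subdigraph D) (eta omega : set (subdigraph D)) (r : nat -> D).

Lemma line_equivE Q R :
  line_equiv Q R <-> linked (verts Q) (verts R) /\ linked (verts R) (verts Q).
Proof. by split=> -[/line_leE ? /line_leE ?]. Qed.

Lemma end_line eta H : is_end eta -> eta H -> is_line H.
Proof. by move=> [Q _ ->] []. Qed.

Lemma end_line_set eta H : is_end eta -> eta H -> line_set (verts H).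
Proof. by move=> e h; apply: is_line_set; exact: end_line h. Qed.

Lemma end_le_mem eta H T : is_end eta -> eta H -> eta T -> linked (verts H) (verts T).
Proof.
move=> [Q lQ ->] [lH /line_equivE[QH HQ]] [lT /line_equivE[QT TQ]].
exact: linked_trans (is_line_set lQ) HQ QT.
Qed.

Lemma end_memP eta H T : is_end eta -> eta H -> is_line T ->
  linked (verts H) (verts T) -> linked (verts T) (verts H) -> eta T.
Proof.
move=> [Q lQ ->] [lH /line_equivE[QH HQ]] lT HT TH; split=> //; apply/line_equivE.
by split; apply: (linked_trans (is_line_set lH)).
Qed.

Lemma end_class H : is_line H -> is_end [set R | is_line R /\ line_equiv H R].
Proof. by move=> lH; exists H. Qed.

Lemma class_self H : is_line H -> [set R | is_line R /\ line_equiv H R] H.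
Proof.
by move=> lH; split=> //; apply/line_equivE; split; apply: linked_refl; exact: is_line_set.
Qed.

Lemma end_eq eta omega H : is_end eta -> is_end omega -> eta H -> omega H -> eta = omega.
Proof.
move=> e o eH oH; have lH := end_line e eH.
by apply/seteqP; split=> T hT;
  [apply: (end_memP o oH) | apply: (end_memP e eH)];
  rewrite ?(end_line e hT) ?(end_line o hT)//;
  do ?[exact: end_line hT]; do ?[exact: (end_le_mem e)]; do ?[exact: (end_le_mem o)].
Qed.

Lemma shared_tail (h h' : nat -> D) (hh : ray_seq h) (hh' : ray_seq h') a b :
  (forall t, h' (a + t) = h (b + t)) -> line_equiv (seq_ray hh) (seq_ray hh').
Proof.
move=> ab; have tl : linked (range (fun t => h (b + t))) (range (fun t => h (b + t))).
  apply: linked_refl; have [hi he] := ray_shift b hh.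
  by exists (fun t => h (b + t)) => //; left.
apply/line_equivE; split; apply: linked_sub tl => _ [s _ <-] /=.
- by exists (b + s).
- by exists (a + s); rewrite ?ab.
- by exists (a + s); rewrite ?ab.
- by exists (b + s).
Qed.

Lemma shared_tail_mem eta (h h' : nat -> D) (hh : ray_seq h) (hh' : ray_seq h') a b : is_end eta ->
  (forall t, h' (a + t) = h (b + t)) -> eta (seq_ray hh) -> eta (seq_ray hh').
Proof.
move=> e ab eh; have /line_equivE[l1 l2] := shared_tail hh hh' ab.
by apply: (end_memP e eh) => //; left; exists (h' 0); exact: seq_ray_from.
Qed.

Lemma counting_set1 (T : choiceType) (x : T) : counting [set x] = 1%:E :> \bar K.
Proof.
by rewrite /counting asboolT ?finite_set1// fset_set1 cardfs1.
Qed.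

Lemma ray_indegree_ge1 eta H : eta H -> is_ray H -> (1 <= indegree K eta)%E.
Proof.
move=> eH rH; apply: ereal_sup_ubound; exists [set H]; last exact: counting_set1.
by split=> [T ->//|S T -> ->].
Qed.

(** Transitivity carries the order from one pair of representatives to all; linking in both
    directions would make the ends equal. *)
Lemma end_minus_le omega eta H R : is_end omega -> end_minus K omega eta ->
  eta H -> omega R ->
  linked (verts H) (verts R) /\ ~ linked (verts R) (verts H).
Proof.
move=> o [e [[Q [T [eQ oT /line_leE QT]]] ne] _] eH oR.
have HR : linked (verts H) (verts R).
  apply: (linked_trans (end_line_set e eQ)); first exact: end_le_mem e eH eQ.
  by apply: (linked_trans (end_line_set o oT)) QT _; exact: end_le_mem o oT oR.
split=> // RH; apply: ne; apply: (end_eq e o eH).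
by apply: (end_memP o oR) => //; exact: end_line e eH.
Qed.

Lemma class_end_minus omega R H : is_end omega -> omega R -> is_ray H ->
  linked (verts H) (verts R) -> ~ linked (verts R) (verts H) ->
  end_minus K omega [set T | is_line T /\ line_equiv H T].
Proof.
move=> o oR rH HR nRH; have lH : is_line H by left.
split; first exact: end_class.
  split; first by exists H, R; split=> //; [exact: class_self | exact/line_leE].
  move=> E; have : omega H by rewrite -E; exact: class_self.
  by move=> oH; apply: nRH; exact: end_le_mem o oR oH.
exact: ray_indegree_ge1 (class_self lH) rH.
Qed.

Lemma tail_shift R x r m (hr : ray_seq r) : ray_from R x ->
  verts R = range r -> (forall t, arcs R (r t) (r t.+1)) ->
  tail (seq_ray (ray_shift m hr)) R.
Proof.
move=> rR vR aR; split; last by left; split; [exists x | exists (r (m + 0)); exact: seq_ray_from].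
split; first by rewrite vR => _ [t _ <-]; exists (m + t).
by move=> u v [t -> ->]; rewrite addnS; exact: aR.
Qed.

Lemma tail_antishift R x r m (inj : injective r) (hr : forall t, edge (r t.+1) (r t)) :
  antiray_to R x -> verts R = range r -> (forall t, arcs R (r t.+1) (r t)) ->
  exists2 Q, tail Q R & verts Q = range (fun t => r (m + t)).
Proof.
move=> rR vR aR; have hm t : edge (r (m + t.+1)) (r (m + t)) by rewrite addnS.
exists (seq_antiray hm) => //; split; last first.
  right; split; [by exists x | exists (r (m + 0))].
  by apply: (@seq_antiray_to D (fun t => r (m + t))) => s t /inj /addnI.
split; first by rewrite vR => _ [t _ <-]; exists (m + t).
by move=> u v [t -> ->]; rewrite addnS; exact: aR.
Qed.

Lemma tail_contains R Q x r : ray_from R x -> injective r ->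
  (forall u v, arcs R u v -> exists2 t, u = r t & v = r t.+1) ->
  r 0 = x -> tail Q R -> exists m, forall t, m <= t -> verts Q (r t).
Proof.
move=> rR inj aR r0 [[_ aQ] [[_ [y /ray_from_seq[q [_ _ vQ arQ _]]]]|[[y /antiray_to_seq[q [_ _ _ vR arR]]] _]]].
  have [m q0 _] := aR _ _ (aQ _ _ (arQ 0)); exists m => t mt.
  rewrite vQ; exists (t - m) => //; rewrite -{2}(subnKC mt).
  elim: (t - m) => [|k IH]; first by rewrite addn0.
  have [s qs ->] := aR _ _ (aQ _ _ (arQ k)).
  by move: qs; rewrite IH addnS => /inj->.
have : verts R x by case: rR.
rewrite vR => -[t _ qt]; have [s _ /esym] := aR _ _ (arR t).
by rewrite qt -r0 => /inj.
Qed.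
End EndFacts.

(** * Exhausting sequences from separating sets *)

Lemma valid_cat (D : digraph) n Z (c : 'I_n -> D) l F : valid Z c l ->
  (forall i, c i \notin F) -> valid (Z ++ F) c l.
Proof.
move=> [vp vu vZ vl vd] cF; split=> //.
  by move=> i; rewrite mem_cat negb_or vZ cF.
by move=> i x /vl xZ; rewrite mem_cat xZ.
Qed.

Lemma ext_path (D : digraph) n (G : set D) Z (c : 'I_n -> D) l i p : valid Z c l ->
  path (@edge D) (c i) p -> uniq (c i :: p) ->
  (forall x, x \in p -> x \notin Z) -> (forall x j, x \in p -> x != c j) ->
  (forall x, x \in p -> G x) ->
  exists Z' l', [/\ ext G c l Z' (upd c i (last (c i) p)) l', {subset Z <= Z'}
    & p <> [::] -> c i \in Z'].
Proof.
have [m] := ubnP (size p); elim: m p Z c l => // m IH [|y p] Z c l pm V pp up pZ pc pG.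
  exists Z, l; split=> //=.
  suff -> : upd c i (c i) = c by exact: ext_refl.
  by apply: funext => j; rewrite /upd; case: eqVneq => // ->.
move: pp up pm => /= /andP[e pp] /andP[ciy /andP[yp up]] pm.
have E : ext G c l (c i :: Z) (upd c i y) (push c l i).
  apply: ext_step => //; [by apply: pZ; rewrite mem_head | | by apply: pG; rewrite mem_head].
  by move=> j; apply: pc; rewrite mem_head.
have [||||||Z' [l' [E' ZZ' _]]] := IH p (c i :: Z) (upd c i y) (push c l i) pm.
- by case: E.
- by rewrite /upd eqxx.
- by rewrite /= /upd eqxx yp.
- move=> x xp; rewrite inE negb_or pZ ?inE ?xp ?orbT// andbT.
  by apply: contraNneq ciy => <-; rewrite inE xp orbT.
- move=> x j xp; rewrite /upd; case: ifP => _; last by apply: pc; rewrite inE xp orbT.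
  by apply: contraNneq yp => <-.
- by move=> x xp; apply: pG; rewrite inE xp orbT.
exists Z', l'; split.
- move: E'; have -> : upd (upd c i y) i (last (upd c i y i) p) = upd c i (last y p).
    by apply: funext => j; rewrite /upd eqxx; have [|] := eqVneq j i.
  exact: ext_trans E.
- by move=> x xZ; apply: ZZ'; rewrite inE xZ orbT.
- by move=> _; apply: ZZ'; rewrite mem_head.
Qed.

Lemma conn_uniq (D : digraph) (X : set D) u v : conn X u v -> exists p,
  [/\ path (@edge D) u p, last u p = v, uniq (u :: p) & forall x, x \in u :: p -> ~ X x].
Proof.
move=> [p0 [pu lu h]]; move: lu; have [p pp up sub] := shortenP pu => lu.
exists p; split=> // x; rewrite inE => xp; apply: h; rewrite inE.
by case/orP: xp => [->//|/sub->]; rewrite orbT.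
Qed.

Section Lower.
Variables (K : realType) (D : digraph) (omega : set (subdigraph D)).
Hypothesis o : is_end omega.
Variables (R : subdigraph D) (x0 : D) (r : nat -> D).
Hypotheses (oR : omega R) (rR : ray_from R x0) (hr : ray_seq r) (r0 : r 0 = x0)
  (vR : verts R = range r)
  (aR : forall u v, arcs R u v -> exists2 t, u = r t & v = r t.+1).
Variable d : nat.
Hypothesis deg : forall n (h : 'I_n -> nat -> D) (hh : forall i, ray_seq (h i)),
  (forall i, omega (seq_ray (hh i))) ->
  (forall i j s t, h i s = h j t -> i = j) -> n <= d.
Variable S : seq D.
Hypothesis sep : separates (lset S) (end_minus K omega) (dom omega) [set omega].

Definition Q m : set D := [set r t | t in [set t | m <= t]].

Lemma Qdec m n : m <= n -> Q n `<=` Q m.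
Proof. by move=> mn _ [t nt <-]; exists t => //; exact: leq_trans nt. Qed.

Definition G m : set D := [set v | exists2 t, m <= t & conn (lset S) (r t) v].

Lemma G_dec m n : m <= n -> G n `<=` G m.
Proof. by move=> mn v [t nt c]; exists t => //; exact: leq_trans nt. Qed.

Lemma G_step m u v : G m u -> u \notin S -> edge u v -> v \notin S -> G m v.
Proof.
move=> [t mt c] uS e vS; exists t => //; apply: conn_trans c _.
by apply: conn_edge => //; exact/negP.
Qed.

Lemma G_conn m u v : G m u -> conn (lset S) u v -> G m v.
Proof. by move=> [t mt c] c'; exists t => //; exact: conn_trans c'. Qed.

Lemma G_off m v : G m v -> v \notin S.
Proof. by move=> [t _ /conn_notr/negP]. Qed.

(** If [h] were not in [omega], its end would be smaller. A walk from a far vertex of [r], followed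
    by [h], would then be a ray of that end starting on the tail and missing [S]. *)
Lemma good_tail : exists m, (forall t, m <= t -> r t \notin S) /\
  forall h (hh : ray_seq h), (forall t, G m (h t)) -> linked (range h) (range r) ->
    omega (seq_ray hh).
Proof.
have [m1 h1] := eventually_off S hr.1.
have [sepe _] := sep; have [T tT sepT] := sepe omega erefl R oR.
have [m2 h2] := tail_contains rR hr.1 aR r0 tT.
exists (maxn m1 m2); split=> [t mt|h hh Gh le_hr].
  by apply: h1; exact: leq_trans (leq_maxl _ _) mt.
apply: contrapT => no.
have lh : is_ray (seq_ray hh) by exists (h 0); exact: seq_ray_from.
have nle : ~ linked (verts R) (verts (seq_ray hh)).
  rewrite vR => le_rh; apply: no; apply: (end_memP o oR); rewrite ?vR//.
  by left.
have [t mt c] := Gh 0.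
have offh s : ~ lset S (h s) by have /G_off/negP := Gh s.
have [h' [hh' h'0 offh' [a [b ab]]]] := ray_prepend hh offh c.
have eqv := shared_tail hh hh' ab.
have cl := @class_end_minus K _ _ _ _ o oR lh.
have [|||y [[s _ <-] Sy]] := sepT _ (seq_ray hh') (h' 0) (cl _ nle) _ (seq_ray_from hh').
- by rewrite vR.
- split=> //; left; exists (h' 0); exact: seq_ray_from.
- by rewrite h'0; apply: h2; exact: leq_trans (leq_maxr _ _) mt.
- exact: offh' Sy.
Qed.

(** The finite-deletion form of an infinite fan from [a] to [r] off [S]. *)
Definition fan a : Prop :=
  forall B : seq D, a \notin B -> forall m, rch Q (lset S `|` lset B) a m.

(** The fan leads to [r] far out, whence [r] and a link lead to [R']. Conversely, [R'] is linked to
    [r], and every tail of [r] reaches [a]. *)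
Lemma fan_dominates a : fan a -> (forall m, G m a) -> dominates a omega.
Proof.
move=> fa Ga; split; first by exists R; split=> //; exists x0.
move=> R' [oR' [x' /ray_from_seq[r' [hr' _ vR' _ _]]]].
have le1 : linked (range r) (verts R') by rewrite -vR; exact: end_le_mem o oR oR'.
have le2 : linked (verts R') (range r) by rewrite -vR; exact: end_le_mem o oR' oR.
split; last first.
  have [u [_ [R'u [t _ <-] c1]]] := le2 [::].
  have [t' tt' c2] := Ga t.
  have [|s ds _] := @dipath_of_conn D set0 (verts R') [set a] u a R'u erefl; last by exists s.
  apply: conn_trans (conn_mono (@sub0set _ _) c1) _.
  apply: conn_trans _ (conn_mono (@sub0set _ _) c2).
  by apply: conn_ray tt' => [|k _ []]; exact: hr.2.
have [F|P [infP Pd inj]] := @greedy_family D (dipath [set a] (verts R')) (seq.filter (predC1 a)).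
  pose B := seq.filter (predC1 a) F.
  have aB : a \notin B by rewrite mem_filter /= eqxx.
  have [m hm] := eventually_off B hr.1.
  have [_ [t mt <-] c1] := fa B aB m.
  have [_ [v [[t' _ <-] R'v c2]]] := le1 (a :: B ++ init r t).
  have tt' : t <= t'.
    apply: (@init_ge D r); apply/negP => k; apply: (conn_notl c2).
    by rewrite /lset /= inE mem_cat k !orbT.
  have va : v <> a by move=> va; apply: (conn_notr c2); rewrite va /lset /= mem_head.
  (* Removing [a] from the target keeps the dipath nontrivial even if [a] lies on [R']. *)
  have [||s ds off] := @dipath_of_conn D (lset B) [set a] (verts R' `\ a) a v erefl.
  - by split.
  - apply: (@conn_trans _ _ (r t)); first by apply: conn_mono c1 => z; right.
    apply: (@conn_trans _ _ (r t')); last first.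
      by apply: conn_mono c2 => z; rewrite /lset /= inE mem_cat => ->; rewrite orbT.
    apply: conn_ray => //; first exact: hr.2.
    by move=> k tk; apply/negP/hm; exact: leq_trans tk.
  case: s ds off => // y p [py up ya [R'l la] int] off.
  exists (y :: p).
    split=> // z zp zy zl [za|R'z]; first by apply: (int z zp zy zl); left.
    have [za|za] := pselect (z = a); first by apply: (int z zp zy zl); left.
    by apply: (int z zp zy zl); right; split.
  split=> [e|z].
    have : last y p \in seq.filter (predC1 a) (y :: p).
      by rewrite mem_filter mem_last andbT /=; apply/eqP.
    by rewrite e.
  rewrite mem_filter /= => /andP[za zp]; apply/negP => zF; apply: (off z zp).
  by rewrite /lset /= mem_filter /= za.
exists P; split=> // s t Ps Pt st; apply/seteqP; split=> [z [zs zt]|_ ->].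
  apply: contrapT => /eqP za; apply: st; apply: (inj s t z Ps Pt);
  by rewrite mem_filter /= za.
by split; [case: s {st} Ps => [/Pd//|y p /Pd[_ _ -> _ _]] |
  case: t {st} Pt => [/Pd//|y p /Pd[_ _ -> _ _]]]; rewrite /= mem_head.
Qed.

(** Otherwise [a] would dominate [omega], and it would be reached off [S] from the tail given by the
    separation property. *)
Lemma fan_leaves a : fan a -> exists m, ~ G m a.
Proof.
move=> fa; apply: contrapT => no.
have Ga m : G m a by apply: contrapT => h; apply: no; exists m.
have [_ sepv] := sep; have [T tT sepT] := sepv omega erefl R oR.
have [m h] := tail_contains rR hr.1 aR r0 tT.
have [t mt c] := Ga m.
have [s ds off] := dipath_of_conn (h t mt) (fan_dominates fa Ga : dom omega a) c.
by have [z [zs Sz]] := sepT s ds; exact: off Sz.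
Qed.

(* A vertex of [F] on such a path for arbitrarily late [t] would make [a] reachable from
   every tail of [r], against [fan_leaves]. *)
Lemma late_paths_avoid (F : seq D) : exists M, forall t a, M <= t -> fan a ->
  conn (lset S) (r t) a -> conn (lset S `|` lset F) (r t) a.
Proof.
have [M hM] : exists M, forall f, f \in F ->
    (forall k, M <= k -> ~ G k f) \/ (forall k, G k f).
  apply: (@uniform_bound _ (fun f M => (forall k, M <= k -> ~ G k f) \/ (forall k, G k f))).
    by move=> f m n mn [h|]; [left=> k nk; apply: h; exact: leq_trans nk | right].
  move=> f _; have [h|/existsNP[m nm]] := pselect (forall k, G k f); first by exists 0; right.
  by exists m; left=> k mk /(G_dec mk).
exists M => t a Mt fa c; have [//|[v [Fv c1 c2]]] := conn_meet (lset F) c.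
case: (hM v Fv) => [/(_ t Mt)|h]; first by case; exists t.
by have [m] := fan_leaves fa; case; exact: G_conn (h m) c2.
Qed.

(** * Rays jumping between vertices with infinite fans *)

Section Fans.
Variable ms : nat.
Hypothesis offS : forall t, ms <= t -> r t \notin S.
Hypothesis fans : forall m, ms <= m -> exists2 a, G m a & fan a.

Lemma new_fan (F : seq D) : exists2 a, G ms a /\ a \notin F & fan a.
Proof.
have [M hM] := late_paths_avoid F.
have [a [t mt c] fa] := fans (leq_maxr M ms).
exists a => //; split.
  by exists t => //; exact: leq_trans (leq_maxr _ _) mt.
have [t' mt' c'] : G (maxn M ms) a by exists t.
apply/negP => aF; apply: (conn_notr (hM t' a _ fa c')); last by right.
exact: leq_trans (leq_maxl _ _) mt'.
Qed.

(** The fan of [x] leads past [F] to [r], which is followed until late enough for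
    [late_paths_avoid]. Adding [x] to the avoided vertices there makes [a] different from [x]. *)
Lemma next_fan x (F : seq D) : fan x -> x \notin F ->
  exists a, [/\ fan a, a != x & conn (lset S `|` lset F) x a].
Proof.
move=> fx xF; have [M hM] := late_paths_avoid (x :: F).
have [m1 h1] := eventually_off F hr.1.
have [_ [t mt <-] c1] := fx F xF (maxn m1 ms).
have [|a [t' mt' c2] fa] := fans (m := maxn t M).
  by apply: leq_trans (leq_maxl _ _); apply: leq_trans mt; exact: leq_maxr.
have /andP[tt' Mt'] : (t <= t') && (M <= t') by rewrite -geq_max.
have c3 := hM t' a Mt' fa c2.
exists a; split=> //.
  by apply/eqP => ax; apply: (conn_notr c3); right; rewrite ax /lset /= mem_head.
apply: conn_trans c1 _; apply: (@conn_trans _ _ (r t')); last first.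
  by apply: conn_mono c3 => z [Sz|Fz]; [left|right; rewrite /lset /= inE Fz orbT].
apply: conn_ray => //; first exact: hr.2.
have /andP[m1t mst] : (m1 <= t) && (ms <= t) by rewrite -geq_max.
move=> k tk [Sk|Fk].
  by have /negP := offS (leq_trans mst tk); apply.
by have /negP := h1 k (leq_trans m1t tk); apply.
Qed.

Section Jump.
Variable n : nat.
Implicit Types (Z : seq D) (c : 'I_n -> D) (l : 'I_n -> seq D).

Definition on_fans Z c l : Prop := valid Z c l /\ forall i, fan (c i) /\ G ms (c i).

Lemma jump_one Z c l i (F : seq D) : on_fans Z c l ->
  exists Z' c' l', [/\ on_fans Z' c' l', ext (G ms) c l Z' c' l', {subset Z <= Z'},
    c' i \notin F & forall j, j != i -> c' j = c j].
Proof.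
move=> [V fG]; have [_ _ vZ _ vd] := V; have [fi Gi] := fG i.
have inj j k : c j = c k -> j = k.
  by move=> e; apply: (vd _ _ (c j)); rewrite ?e mem_head.
pose B := seq.filter (predC1 (c i)) (F ++ Z ++ codom c).
have ciB : c i \notin B by rewrite mem_filter /= eqxx.
have [a [fa ai /conn_uniq[p [pp lp up offp]]]] := next_fan fi ciB.
have pi x : x \in p -> x != c i.
  by move=> xp; apply: contraTneq xp => ->; case/andP: up.
have pB x : x \in p -> x \notin F ++ Z ++ codom c.
  move=> xp; apply/negP => xB; apply: (offp x); first by rewrite inE xp orbT.
  by right; rewrite /lset /= mem_filter /= pi.
have pG x : x \in c i :: p -> G ms x.
  move=> xp; apply: G_conn Gi _; apply: path_conn_prefix pp xp _ => y yp Sy.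
  by apply: (offp y yp); left.
have [|||Z' [l' [E ZZ' ciZ']]] := @ext_path D n (G ms) Z c l i p V pp up.
- by move=> x /pB; rewrite !mem_cat !negb_or => /and3P[].
- move=> x j /pB; rewrite !mem_cat !negb_or => /and3P[_ _].
  by apply: contraNneq => ->; exact: codom_f.
- by move=> x xp; apply: pG; rewrite inE xp orbT.
have ap : a \in p.
  by have := mem_last (c i) p; rewrite lp inE (negPf ai).
exists Z', (upd c i (last (c i) p)), l'; split=> //.
- split; first by case: E.
  move=> j; rewrite /upd; case: ifP => // _; rewrite lp; split=> //.
  by apply: pG; rewrite inE ap orbT.
- by rewrite /upd eqxx lp; move: (pB a ap); rewrite mem_cat negb_or => /andP[].
- by move=> j ji; rewrite /upd (negPf ji).
Qed.

Lemma jump_all Z c l (F : seq D) (s : seq 'I_n) : on_fans Z c l ->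
  exists Z' c' l', [/\ on_fans Z' c' l', ext (G ms) c l Z' c' l', {subset Z <= Z'}
    & forall i, i \in s -> c' i \notin F].
Proof.
elim: s => [|i s IH] I; first by exists Z, c, l; split=> //; apply: ext_refl; case: I.
have [Z1 [c1 [l1 [I1 E1 Z01 h1]]]] := IH I.
have [Z2 [c2 [l2 [I2 E2 Z12 h2 e2]]]] := jump_one i F I1.
exists Z2, c2, l2; split=> //; first exact: ext_trans E1 E2.
  by move=> x /Z01/Z12.
move=> j; rewrite inE; have [-> //|ji /= js] := eqVneq j i.
by rewrite e2// h1.
Qed.

(** All paths first jump to end vertices off the walks [f i]; only then can these walks be added to
    the used vertices. *)
Lemma fan_round Z c l k : on_fans Z c l -> exists Z' c' l', grows Q (G ms) on_fans k Z c l Z' c' l'.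
Proof.
move=> I; have [V fG] := I; have [_ _ vZ _ _] := V.
have [|f hf] := @choice 'I_n (seq D) (fun i L => [/\ path (@edge D) (c i) L,
    Q k (last (c i) L) & forall x, x \in c i :: L -> x \notin Z]).
  move=> i; have [w Qw [L [pL lL hL]]] := (fG i).1 Z (vZ i) k.
  exists L; split=> //; first by rewrite lL.
  by move=> x /hL h; apply/negP => xZ; apply: h; right.
pose F := flatten [seq c i :: f i | i <- enum 'I_n].
have [Z' [c' [l' [[V' fG'] [_ E] ZZ' h]]]] := jump_all F (enum 'I_n) I.
have V2 : valid (Z' ++ F) c' l'.
  by apply: valid_cat => // i; apply: h; rewrite mem_enum.
exists (Z' ++ F), c', l'; split=> //.
- by move=> x /ZZ' xZ; rewrite mem_cat xZ.
- move=> i; have [pf Qf nf] := hf i; exists (f i); split=> // x xf.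
  rewrite mem_cat; apply/orP; right; apply/flattenP; exists (c i :: f i) => //.
  by apply: map_f; rewrite mem_enum.
Qed.

Lemma fan_rays : exists h : 'I_n -> nat -> D, [/\ forall i, ray_seq (h i),
  forall i t, G ms (h i t), forall i j s t, h i s = h j t -> i = j
  & forall i, linked (range (h i)) (range r)].
Proof.
have [s [us ss fs]] : exists s : seq D, [/\ uniq s, size s = n
    & forall x, x \in s -> fan x /\ G ms x].
  elim: (n) => [|k [s [us <- fs]]]; first by exists [::].
  have [a [Ga aS] fa] := new_fan s; exists (a :: s); split=> //=; first by rewrite aS.
  by move=> x; rewrite inE => /predU1P[->|/fs].
pose c (i : 'I_n) := nth (r 0) s i.
have cs i : c i \in s by apply: mem_nth; rewrite ss.
have I : on_fans [::] c (fun=> [::]).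
  split; last by move=> i; exact: fs.
  split=> // i j x; rewrite !inE => /eqP-> /eqP e.
  by apply/val_inj/eqP; rewrite /= -(nth_uniq (r 0) _ _ us) ?ss//; exact/eqP.
have [|h [h1 h2 h3 h4]] := limit_rays Qdec fan_round I I.1.
  by move=> i; have [] := fs _ (cs i).
exists h; split=> // i F; have [t [w [t' _ <-] cw]] := h4 i F.
by exists (h i t), (r t'); split; [exists t|exists t'|].
Qed.
End Jump.
End Fans.

(** Fan vertices arbitrarily far out would yield [d.+1] disjoint rays, all in [omega] by
    [good_tail]. *)
Lemma no_fans : exists m, [/\ forall t, m <= t -> r t \notin S,
  forall h (hh : ray_seq h), (forall t, G m (h t)) -> linked (range h) (range r) ->
    omega (seq_ray hh)
  & forall a, G m a -> ~ fan a].
Proof.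
have [ms [offS ray_mem]] := good_tail.
have [h|h] := pselect (exists2 m, ms <= m & forall a, G m a -> ~ fan a).
  have [m msm nf] := h; exists m; split=> //.
    by move=> t mt; apply: offS; exact: leq_trans mt.
  by move=> h' hh Gh; apply: ray_mem => t; exact: G_dec msm _ (Gh t).
have fans m : ms <= m -> exists2 a, G m a & fan a.
  move=> msm; apply: contrapT => no; apply: h; exists m => // a Ga fa.
  by apply: no; exists a.
have [hs [h1 h2 h3 h4]] := fan_rays offS fans d.+1.
have : d.+1 <= d; last by rewrite ltnn.
by apply: (@deg _ hs h1 _ h3) => i; exact: ray_mem.
Qed.
End Lower.

Lemma cut_trans (D : digraph) (Q : nat -> set D)
  (Qdec : forall m n, m <= n -> Q n `<=` Q m) (X V : set D) (A : seq D) w :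
  cut Q (X `|` lset A) w -> (forall a, a \in A -> cut Q (X `|` V) a) -> cut Q (X `|` V) w.
Proof.
move=> [m1 h1] cA; apply: contrapT => /not_cut nc.
have [m2 h2] := cut_uniform Qdec A (fun _ => X `|` V).
have [v Qv c] := nc (maxn m1 m2).
have [c'|[a [aA _ c']]] := conn_meet (lset A) c.
  apply: h1; exists v; first exact: Qdec (leq_maxl _ _) _ Qv.
  by apply: conn_mono c' => x [Xx|Ax]; [left; left|right].
apply: (h2 a aA (cA a aA)); exists v => //; exact: Qdec (leq_maxr _ _) _ Qv.
Qed.

(** * Disjoint cuts moving towards the end *)

Section Sequence.
Variables (D : digraph) (omega : set (subdigraph D)) (r : nat -> D) (d : nat) (S : seq D).
Hypothesis deg : forall n (h : 'I_n -> nat -> D) (hh : forall i, ray_seq (h i)),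
  (forall i, omega (seq_ray (hh i))) ->
  (forall i j s t, h i s = h j t -> i = j) -> n <= d.
Variable ms : nat.
Hypothesis offS : forall t, ms <= t -> r t \notin S.
Hypothesis ray_mem : forall h (hh : ray_seq h), (forall t, G r S ms (h t)) ->
  linked (range h) (range r) -> omega (seq_ray hh).
Hypothesis nofan : forall a, G r S ms a -> ~ fan r S a.
Hypothesis le_omega : forall T, rays omega T ->
  linked (verts T) (range r) /\ linked (range r) (verts T).

Let QQ := Q r.
Let QQdec : forall m n, m <= n -> QQ n `<=` QQ m := @Qdec D r.
Let GG := G r S ms.

Lemma nonfan a : GG a -> exists B : seq D,
  a \notin B /\ exists m, ~ rch QQ (lset S `|` lset B) a m.
Proof.
move=> Ga; have /existsNP[B /not_implyP[aB /existsNP[m h]]] := nofan Ga.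
by exists B; split=> //; exists m.
Qed.

(** A walk off [S] from [a] stays in [GG], so it can meet [Y] only there. *)
Lemma cut_reachable (Y : seq D) a : GG a -> cut QQ (lset S `|` lset Y) a ->
  cut QQ (lset S `|` lset [seq y <- Y | `[< GG y >]]) a.
Proof.
move=> Ga [m h]; exists m => -[w Qw c]; apply: h.
have [c'|[y [Yy c' _]]] := conn_meet (lset Y) c.
  by exists w => //; apply: conn_mono c' => x [Sx|Yx]; [left; left|right].
case: (conn_notr c'); right; rewrite /lset /= mem_filter Yy andbT; apply/asboolP.
by apply: G_conn Ga _; apply: conn_mono c' => x; left.
Qed.

(** The vertices of a smallest cut are big, since a smaller cut of them would also cut off [A]. They
    start as many disjoint rays, which belong to [omega]. *)
Lemma small_cut (A : seq D) : (forall a, a \in A -> GG a) -> exists Y : seq D,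
  [/\ size Y <= d, forall y, y \in Y -> GG y
    & forall a, a \in A -> cut QQ (lset S `|` lset Y) a].
Proof.
move=> AG.
pose P n := exists2 Y, size Y = n & forall a, a \in A -> cut QQ (lset S `|` lset Y) a.
have [|N [Y0 sY0 cY0] Nmin] := @ex_minimal_nat P.
  by exists (size A), A => // a aA; apply: cut_in; right.
pose Y := [seq y <- Y0 | `[< GG y >]].
have cY a : a \in A -> cut QQ (lset S `|` lset Y) a.
  by move=> aA; apply: cut_reachable; [exact: AG | exact: cY0].
have YG y : y \in Y -> GG y by rewrite mem_filter => /andP[/asboolP].
have sY : size Y = N.
  apply/eqP; rewrite eqn_leq -{1}sY0 size_filter count_size /=.
  by rewrite -size_filter; apply: Nmin; exists Y.
exists Y; split=> //; rewrite sY.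
pose c (i : 'I_N) := nth (r 0) Y i.
have cG i : GG (c i) by apply: YG; apply: mem_nth; rewrite sY.
have bg : big QQ (lset S) c.
  move=> Z sZ; apply: contrapT => all.
  have : N <= size Z; last by rewrite leqNgt sZ.
  apply: Nmin; exists Z => // a aA; apply: (cut_trans QQdec (cY a aA)) => y yY.
  apply: contrapT => ny; apply: all.
  have iN : index y Y < N by rewrite -sY index_mem.
  by exists (Ordinal iN); rewrite /c /= nth_index.
have st : state QQ S GG S c (fun=> [::]).
  split=> //; split=> // [i|i j x].
    by apply/negP; exact: (big_notin bg).
  by rewrite !inE => /eqP-> /eqP; exact: (big_inj bg).
have nx Z (c' : 'I_N -> D) l k : state QQ S GG Z c' l ->
    exists Z' c'' l', grows QQ GG (state QQ S GG) k Z c' l Z' c'' l'.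
  have [Gst nf] : (forall u v, GG u -> u \notin S -> edge u v -> v \notin S -> GG v) /\
      forall x, GG x -> exists B : seq D,
        x \notin B /\ exists m, ~ rch QQ (lset S `|` lset B) x m.
    by split; [exact: G_step | exact: nonfan].
  move=> /(big_round QQdec Gst nf k)[Z' [c'' [l' [[st' E ZZ'] hL]]]].
  by exists Z', c'', l'; split.
have [||h [h1 h2 h3 h4]] := limit_rays QQdec nx st.
- by case: st.
- by [].
apply: (@deg _ h h1 _ h3) => i; apply: ray_mem => [|F]; first exact: h2.
have [t [w [t' _ <-] cw]] := h4 i F.
by exists (h i t), (r t'); split; [exists t|exists t'|].
Qed.

(** Each [w] has a finite cut [f w] not containing it. The vertices of these cuts outside [W] cut
    off all of [W], because a walk has a last vertex in [W]; this cut is then replaced by a small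
    one. *)
Lemma fresh_cut (W : seq D) : (forall w, w \in W -> GG w) -> exists V : seq D,
  [/\ size V <= d, forall v, v \in V -> GG v /\ v \notin W
    & forall w, w \in W -> cut QQ (lset S `|` lset V) w].
Proof.
move=> WG.
have [|f hf] := @choice D (seq D) (fun w B => GG w ->
    [/\ forall b, b \in B -> GG b, w \notin B & cut QQ (lset S `|` lset B) w]).
  move=> w; have [Gw|nG] := pselect (GG w); last by exists [::].
  have [B [wB cB]] := nonfan Gw.
  exists [seq y <- B | `[< GG y >]] => _; split; last exact: cut_reachable.
    by move=> b; rewrite mem_filter => /andP[/asboolP].
  by rewrite mem_filter negb_and wB orbT.
pose A := [seq b <- flatten [seq f w | w <- W] | b \notin W].
have AG a : a \in A -> GG a.
  rewrite mem_filter => /andP[_ /flattenP[B /mapP[w wW ->]]].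
  by have [h _ _] := hf w (WG w wW); exact: h.
have WA w : w \in W -> cut QQ (lset S `|` lset A) w.
  move=> wW; have [m hm] := cut_uniform QQdec W (fun v => lset S `|` lset (f v)).
  exists m => -[u Qu c].
  have [/conn_notl|[v [q [Wv cv pq lq [hq qW]]]]] := conn_last (lset W) c.
    by apply; right.
  have [_ vf cutv] := hf v (WG v Wv); apply: (hm v Wv cutv); exists u => //.
  exists q; split=> // x xq [Sx|fx]; first by apply: (hq x xq); left.
  have xv : x != v by apply: contraNneq vf => e; move: fx; rewrite e.
  move: (xq); rewrite inE (negPf xv) /= => xq'; apply: (hq x xq); right.
  rewrite /lset /= mem_filter; apply/andP; split; first by apply/negP; exact: qW.
  by apply/flattenP; exists (f v) => //; exact: map_f.
have [Y [sY YG cY]] := small_cut AG.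
(* Only the vertices of [Y] that are in [A] or not cut off by [A] are needed, and none
   of these is in [W]. *)
pose keep y := `[< ~ cut QQ (lset S `|` lset A) y >] || (y \in A).
have AV a : a \in A -> cut QQ (lset S `|` lset (seq.filter keep Y)) a.
  move=> aA.
  have [m1 h1] := cut_uniform QQdec A (fun=> lset S `|` lset Y).
  have [m2 h2] := cut_uniform QQdec Y (fun=> lset S `|` lset A).
  exists (maxn m1 m2) => -[u Qu c].
  (* Beyond its last vertex in [A] the walk meets [Y] in a discarded vertex. That vertex is cut off
     by [A], yet the rest of the walk avoids [A]. *)
  have [/conn_notl|[v [q [Av cv pq lq [hq qA]]]]] := conn_last (lset A) c.
    by apply; right.
  apply: (h1 v Av (cY v Av)); exists u; first exact: QQdec (leq_maxl _ _) _ Qu.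
  exists q; split=> // x xq [Sx|Yx]; first by apply: (hq x xq); left.
  have : ~~ keep x.
    apply/negP => kx; apply: (hq x xq); right; by rewrite /lset /= mem_filter kx.
  rewrite negb_or => /andP[/asboolPn/contrapT cx xA].
  apply: (h2 x Yx cx); exists u; first exact: QQdec (leq_maxr _ _) _ Qu.
  have xv : x != v by apply: contraNneq xA => ->.
  move: xq; rewrite inE (negPf xv) /= => xq.
  case: q pq lq hq qA xq => // b q /= /andP[e pb] lb hq qA xq.
  rewrite -lb; apply: path_conn_suffix => // z zq [Sz|Az]; last exact: qA zq Az.
  by apply: (hq z); [rewrite inE zq orbT | left].
exists (seq.filter keep Y); split.
- by apply: leq_trans sY; rewrite size_filter count_size.
- move=> v; rewrite mem_filter => /andP[kv vY]; split; first exact: YG.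
  apply/negP => vW; case/orP: kv => [/asboolP|]; first by apply; exact: WA.
  by rewrite mem_filter vW.
- by move=> w wW; apply: (cut_trans QQdec (WA w wW)).
Qed.

Lemma ray_rch (q : nat -> D) (Y : seq D) s m : ray_seq q -> linked (range q) (range r) ->
  (forall t, s <= t -> q t \notin Y) -> rch QQ (lset Y) (q s) m.
Proof.
move=> hq qr off.
have [_ [_ [[t _ <-] [t' _ <-] c]]] := qr (Y ++ init q s ++ init r m).
have sub (Z1 Z2 : seq D) : lset Z1 `<=` lset (Z1 ++ Z2).
  by move=> x; rewrite /lset /= mem_cat => ->.
have st : s <= t.
  apply: (@init_ge D q); apply/negP => k; apply: (conn_notl c).
  by rewrite /lset /= !mem_cat k !orbT.
have mt' : m <= t'.
  apply: (@init_ge D r); apply/negP => k; apply: (conn_notr c).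
  by rewrite /lset /= !mem_cat k !orbT.
exists (r t'); first by exists t'.
apply: conn_trans (conn_mono (sub _ _) c).
apply: conn_ray st; first exact: hq.2.
by move=> k sk; exact/negP/off.
Qed.

Lemma exhausting_cuts : exists V : nat -> seq D, [/\ forall i, size (V i) <= d
  & exhausting omega (fun i => lset (S ++ V i))].
Proof.
have rG t : ms <= t -> GG (r t).
  by move=> mt; exists t => //; apply/conn_refl/negP/offS.
have [|v hv] := @choice (seq D) (seq D) (fun W V => (forall w, w \in W -> GG w) ->
   [/\ size V <= d, forall v, v \in V -> GG v /\ v \notin W
    & forall w, w \in W -> cut QQ (lset S `|` lset V) w]).
  move=> W; have [WG|nW] := pselect (forall w, w \in W -> GG w); last by exists [::].
  by have [V h] := fresh_cut WG; exists V.
(* Adding [r (ms + i')] ensures that each late vertex of [r] is eventually cut off; keeping the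
   earlier cuts makes the cuts disjoint. *)
pose W := fix W i := if i is i'.+1 then r (ms + i') :: v (W i') ++ W i' else [::].
have WG i w : w \in W i -> GG w.
  elim: i w => // i IH w; rewrite inE mem_cat => /or3P[/eqP->|wv|/IH//].
    by apply: rG; rewrite leq_addr.
  by have [_ h _] := hv (W i) (IH); have [] := h w wv.
pose V i := v (W i).
have {hv} hV i := hv (W i) (WG i).
have mono i j x : i <= j -> x \in W i -> x \in W j.
  move=> /subnK <-; elim: (j - i) => // k IH /IH xW.
  by rewrite addSn /= inE mem_cat xW !orbT.
have VW i j x : i < j -> x \in V i -> x \in W j.
  by move=> ij xV; apply: mono ij _; rewrite /= inE mem_cat xV !orbT.
have Vonce (x : D) : exists M, forall i, M <= i -> x \notin V i.
  have [[p xp]|no] := pselect (exists p, x \in V p); last first.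
    by exists 0 => i _; apply/negP => xi; apply: no; exists i.
  exists p.+1 => i pi; apply/negP => xi; have [_ h _] := hV i.
  by have [_ /negP] := h x xi; apply; exact: VW pi xp.
have lsetU (Y1 Y2 : seq D) : lset Y1 `|` lset Y2 = lset (Y1 ++ Y2).
  by apply/seteqP; split=> x; rewrite /lset /= mem_cat;
    [case=> -> //; rewrite orbT | case/orP; [left|right]].
exists V; split; first by move=> i; have [] := hV i.
split=> [i|T oT|i T oT].
- exact: finite_seq.
- have [le1 le2] := le_omega oT; have [_ [x1 /ray_from_seq[q [hq _ vT _ _]]]] := oT.
  rewrite vT in le1 le2 *.
  apply: contrapT => no.
  have miss i s : q s \notin S ++ V i.
    by apply/negP => qi; apply: no; exists i, (q s); split => //; exists s.
  have [_ [_ [[t _ <-] [s _ <-] c]]] := le2 (S ++ init r ms).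
  have mt : ms <= t.
    apply: (@init_ge D r); apply/negP => k; apply: (conn_notl c).
    by rewrite /lset /= mem_cat k orbT.
  have [p [pp lp offp]] := c.
  (* The finite walk from [r t] to the ray misses all late cuts. If the ray missed them too, [r t]
     would not be cut off. *)
  have [M hM] : exists M, forall x, x \in r t :: p -> forall i, M <= i -> x \notin V i.
    apply: (@uniform_bound _ (fun x M => forall i, M <= i -> x \notin V i)).
      by move=> x a b ab h i bi; apply: h; exact: leq_trans bi.
    by move=> x _; exact: Vonce.
  pose i := maxn M (t - ms).+1.
  have [_ _ cutW] := hV i.
  have [|m] := cutW (r t).
    apply: (@mono (t - ms).+1); first exact: leq_maxr.
    by rewrite /= subnKC// mem_head.
  apply; apply: (@rch_conn _ _ _ _ (q s)); last first.
    by rewrite lsetU; apply: ray_rch => // k _; exact: miss.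
  exists p; split=> // x xp [Sx|Vx].
    by apply: (offp x xp); rewrite /lset /= mem_cat Sx.
  by have := hM x xp i (leq_maxl _ _); rewrite Vx.
- have [le1 _] := le_omega oT; have [_ [x1 /ray_from_seq[q [hq _ vT _ _]]]] := oT.
  rewrite vT in le1 * => -[_ [[s _ <-] qi]].
  have [[k qS]|noS] := pselect (exists k, q k \in S).
    by exists (q k); split; [exists k | rewrite /lset /= mem_cat qS].
  have qV : q s \in V i.
    move: qi; rewrite /lset /= mem_cat => /orP[qS|//].
    by case: noS; exists s.
  have [_ _ cutW] := hV i.+1.
  (* The vertex in [V i] is cut off by [S] and [V i.+1], so the ray, being linked to [r], cannot
     miss both. *)
  have [m] := cutW (q s) (VW _ _ _ (ltnSn i) qV).
  apply: contra_notP => no; rewrite lsetU; apply: ray_rch => // k _.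
  by apply/negP => qk; apply: no; exists (q k); split => //; exists k.
Qed.
End Sequence.

(** * Separating sets from exhausting sequences *)

Lemma disjoint_hits (T : eqType) m (g : 'I_m -> nat -> T) (Y : seq T) :
  (forall i j s t, g i s = g j t -> i = j) -> (forall i, exists t, g i t \in Y) ->
  m <= count (fun y => `[< exists i t, y = g i t >]) Y.
Proof.
move=> inj hit; have [f hf] := choice hit.
pose s := [seq g i (f i) | i <- enum 'I_m].
have us : uniq s.
  by rewrite map_inj_uniq ?enum_uniq// => i j /inj.
have : size s <= size (seq.filter (fun y => `[< exists i t, y = g i t >]) Y).
  apply: uniq_leq_size us _ => _ /mapP[i _ ->].
  by rewrite mem_filter hf andbT; apply/asboolP; exists i, (f i).
by rewrite size_map size_enum_ord size_filter.
Qed.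

Section Upper.
Variables (K : realType) (D : digraph) (omega : set (subdigraph D)).
Hypothesis o : is_end omega.
Variable u : nat -> seq D.
Hypothesis u_meets : forall h (hh : ray_seq h), omega (seq_ray hh) ->
  exists i s, h s \in u i.
Hypothesis u_next : forall h (hh : ray_seq h) i, omega (seq_ray hh) ->
  (exists s, h s \in u i) -> exists s, h s \in u i.+1.
Variable k : nat.
Hypothesis u_small : forall m, exists2 i, m <= i & size (u i) <= k.

Lemma u_later h (hh : ray_seq h) i j : omega (seq_ray hh) -> i <= j ->
  (exists s, h s \in u i) -> exists s, h s \in u j.
Proof.
move=> oh /subnK <-; elim: (j - i) => // l IH /IH; rewrite addSn.
exact: (u_next (hh := hh)).
Qed.

(* [S0] has maximal size among the sets contained in infinitely many small [u i]. *)
Lemma kernel : exists S0 : seq D,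
  (forall m, exists i, [/\ m <= i, size (u i) <= k & {subset S0 <= u i}]) /\
  forall F : seq D, (forall x, x \in F -> x \notin S0) -> exists M, forall i, M <= i ->
    size (u i) <= k -> {subset S0 <= u i} -> forall x, x \in F -> x \notin u i.
Proof.
pose P j := exists2 L : seq D, uniq L /\ size L = j &
  forall m, exists i, [/\ m <= i, size (u i) <= k & {subset L <= u i}].
have [||j [S0 [uS sS] infS] jmax] := @ex_maximal_nat P 0 k.
- exists [::] => // m; have [i mi si] := u_small m; by exists i; split.
- move=> _ [L [uL <-] infL]; have [i [_ si Li]] := infL 0.
  exact: leq_trans (uniq_leq_size uL Li) si.
exists S0; split=> // F FS.
have [M hM] : exists M, forall x, x \in F -> forall i, M <= i -> size (u i) <= k ->
    {subset S0 <= u i} -> x \notin u i.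
  apply: (@uniform_bound _ (fun x M => forall i, M <= i -> size (u i) <= k ->
    {subset S0 <= u i} -> x \notin u i)).
    by move=> x m n mn h i ni; apply: h; exact: leq_trans ni.
  move=> x xF; apply: contrapT => no.
  have : j.+1 <= j; last by rewrite ltnn.
  apply: jmax; exists (x :: S0); first by rewrite /= sS uS (FS x xF).
  move=> m; apply: contrapT => none; apply: no; exists m => i mi si Si.
  apply/negP => xi; apply: none; exists i; split=> // y.
  by rewrite inE => /predU1P[->|/Si].
by exists M => i Mi si Si x xF; exact: hM.
Qed.

(** * The separator taken from a late small set *)

Section Separator.
Variables (d : nat) (h : 'I_d -> nat -> D) (hh : forall i, ray_seq (h i)).
Hypothesis oh : forall i, omega (seq_ray (hh i)).
Hypothesis h_disj : forall i j s t, h i s = h j t -> i = j.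
Variable S0 : seq D.
Let idx i := size (u i) <= k /\ {subset S0 <= u i}.
Hypothesis idx_inf : forall m, exists2 i, m <= i & idx i.
Hypothesis idx_avoid : forall F : seq D, (forall x, x \in F -> x \notin S0) ->
  exists M, forall i, M <= i -> idx i -> forall x, x \in F -> x \notin u i.
Hypothesis h_off : forall i t, h i t \notin S0.
Variables (i0 : 'I_d) (s0 iq : nat).
Let r := h i0.
Let q := r s0.
Hypothesis q_iq : q \in u iq.

Let le_r g (hg : ray_seq g) : omega (seq_ray hg) -> linked (range g) (range r).
Proof. by move=> og; exact: end_le_mem o og (oh i0). Qed.

(** Late sets miss the walk from [q] to [v]. If [v] were not cut off, a ray of [omega] would start
    at [q], end in a tail of [r] and miss [u i]; but it contains [q] and so meets all sets from
    [u iq] on. *)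
Lemma eventually_cut v : conn (lset S0) q v ->
  exists M, forall i, M <= i -> idx i -> cut (Q r) (lset (u i)) v.
Proof.
move=> [p [pp lp offp]].
have [|M hM] := idx_avoid (F := q :: p).
  by move=> x /offp/negP.
exists (maxn M iq) => i; rewrite geq_max => /andP[Mi iqi] Ii.
apply: contrapT => /not_cut nc.
have [m hm] := eventually_off (u i) (hh i0).1.
have [_ [t mt <-] c1] := nc m.
have c2 : conn (lset (u i)) q (r t).
  apply: conn_trans c1; exists p; split=> // x xp; exact/negP/hM.
have hrt := ray_shift m (hh i0); rewrite -/r in hrt.
have [||g [hg g0 goff [a [b ab]]]] := @ray_prepend D (lset (u i)) _ q (t - m) hrt.
- by move=> s; apply/negP/hm; exact: leq_addr.
- by rewrite subnKC.
have og : omega (seq_ray hg).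
  apply: (@shared_tail_mem D omega r g (hh i0) hg a (m + b) o _ (oh i0)).
  by move=> s; rewrite ab addnA.
have [|s gs] := u_later (hh := hg) og iqi.
  by exists 0; rewrite g0.
exact: goff gs.
Qed.

Lemma not_dominates v : conn (lset S0) q v -> ~ dom omega v.
Proof.
move=> c [_ domv].
have rr : rays omega (seq_ray (hh i0)).
  by split; [exact: oh | exists (r 0); exact: seq_ray_from].
have [[P [infP Pd PI]] _] := domv _ rr.
have [M1 h1] := eventually_cut c.
have [|M2 h2] := idx_avoid (F := [:: v]).
  by move=> x; rewrite inE => /eqP->; apply/negP; exact: conn_notr c.
have [i Mi Ii] := idx_inf (maxn M1 M2).
have [M1i M2i] : M1 <= i /\ M2 <= i by apply/andP; rewrite -geq_max.
have vu : v \notin u i by apply: h2 => //; rewrite mem_head.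
have [m hm] := h1 i M1i Ii.
(* The centre [v] lies on every member of the fan, so it excludes just the one-vertex dipath. *)
pose hit f s := if f == v then s = [:: v] else f \in (s : seq D).
have [|s Ps nohit] := @infinite_avoid D P hit (v :: u i ++ init r m) infP.
  move=> f s t _ Ps Pt; rewrite /hit; have [_ -> ->//|fv fs ft] := eqVneq f v.
  apply: contrapT => st; have : ([set` s] `&` [set` t]) f by [].
  by rewrite (PI s t Ps Pt st) /= => /eqP; rewrite (negPf fv).
have off f : f \in u i ++ init r m -> f \in s -> f = v.
  move=> fF fs; apply/eqP/negPn/negP => fv; apply: (nohit f).
    by rewrite inE fF orbT.
  by rewrite /hit (negPf fv).
have sv : s <> [:: v] by move=> e; apply: (nohit v); rewrite ?mem_head// /hit eqxx.
case: s Ps nohit off sv => [/Pd//|y p] Ps _ off sv.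
have [pp up yv [t _ rt] _] := Pd _ Ps; change (r t = last y p) in rt; rewrite yv in pp up rt off sv.
case: p {Ps} pp up rt off sv => [//|a p] pp up rt off _.
apply: hm; exists (r t).
  exists t => //; apply: (@init_ge D r); apply/negP => rm.
  have : r t \in a :: p by rewrite rt /= mem_last.
  rewrite (off (r t)) ?mem_cat ?rm ?orbT//; last by rewrite rt /= inE mem_last orbT.
  by case/andP: up => /negPf->.
rewrite rt; exists (a :: p); split=> // x xs xu.
by move: vu; rewrite -(off x) ?xu ?mem_cat ?xu.
Qed.

Definition low_ray g : Prop :=
  exists hg : ray_seq g, [/\ exists2 eta, end_minus K omega eta & eta (seq_ray hg),
    forall t, g t \notin S0 & conn (lset S0) q (g 0)].

Lemma low_ray_le g : low_ray g ->
  linked (range g) (range r) /\ forall i, ~ linked (range (h i)) (range g).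
Proof.
move=> [hg [[eta me eg] _ _]]; split.
  by have [] := end_minus_le o me eg (oh i0).
by move=> i; have [] := end_minus_le o me eg (oh i).
Qed.

Lemma low_ray_shift g m : low_ray g -> low_ray (fun t => g (m + t)).
Proof.
move=> [hg [[eta me eg] off c]]; exists (ray_shift m hg); split=> //.
  exists eta => //; have [ee _ _] := me.
  by apply: (@shared_tail_mem D eta _ _ hg (ray_shift m hg) 0 m ee _ eg).
rewrite addn0; apply: conn_trans c _; apply: conn_ray => //; first exact: hg.2.
by move=> t _; exact/negP/off.
Qed.

(** The start of [g] is eventually cut off, whereas [g] is linked to [r]. *)
Lemma low_ray_hit g : low_ray g ->
  exists M, forall i, M <= i -> idx i -> exists t, g t \in u i.
Proof.
move=> lg; have [gr _] := low_ray_le lg; have [hg [_ off c]] := lg.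
have [M hM] := eventually_cut c; exists M => i Mi Ii.
have [m] := hM i Mi Ii; apply: contra_notP => no.
by apply: ray_rch => // t _; apply/negP => gt; apply: no; exists t.
Qed.

(** Disjoint low rays all meet a common late set of at most [k] vertices, so a maximal disjoint
    family is finite. *)
Lemma max_low_rays : exists m (g : 'I_m -> nat -> D), (forall j, low_ray (g j)) /\
  forall g', low_ray g' -> exists s j t, g' s = g j t.
Proof.
pose P m := exists2 g : 'I_m -> nat -> D, forall j, low_ray (g j) &
  forall i j s t, g i s = g j t -> i = j.
have [||m [g lg dg] mmax] := @ex_maximal_nat P 0 k.
- by exists (fun _ => r) => [[]|[]].
- move=> m [g lg dg].
  have [M hM] : exists M, forall j, j \in enum 'I_m -> forall i, M <= i -> idx i ->
      exists t, g j t \in u i.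
    apply: (@uniform_bound _ (fun j M => forall i, M <= i -> idx i ->
      exists t, g j t \in u i)).
      by move=> x a b ab hx i bi; apply: hx; exact: leq_trans bi.
    by move=> j _; exact: low_ray_hit.
  have [i Mi Ii] := idx_inf M.
  apply: leq_trans Ii.1; apply: leq_trans (disjoint_hits dg _) (count_size _ _).
  by move=> j; apply: hM => //; rewrite mem_enum.
exists m, g; split=> // g' lg'; apply: contrapT => no.
have : m.+1 <= m; last by rewrite ltnn.
apply: mmax.
exists (fun i : 'I_m.+1 => if unlift ord0 i is Some j then g j else g').
  by move=> i; case: unliftP.
move=> i j s t; case: unliftP => [i' ->|->]; case: unliftP => [j' ->|->] //.
- by move=> /dg ->.
- by move=> e; case: no; exists t, i', s.
- by move=> e; case: no; exists s, j', t.
Qed.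

Lemma separator : exists Y : seq D, d + size Y <= k /\
  separates (lset Y) (end_minus K omega) (dom omega) [set omega].
Proof.
have [m [g [lg gmax]]] := max_low_rays.
have [F hF] : exists F : seq D, forall i j s t, ~ conn (lset F) (h i s) (g j t).
  have [|f hf] := @choice ('I_d * 'I_m) (seq D) (fun ij F =>
      forall s t, ~ conn (lset F) (h ij.1 s) (g ij.2 t)).
    move=> [i j]; have [_ /(_ i)/existsNP[F hF]] := low_ray_le (lg j).
    by exists F => s t c; apply: hF; exists (h i s), (g j t); split; [exists s|exists t|].
  exists (flatten [seq f ij | ij <- enum {: 'I_d * 'I_m}]) => i j s t c.
  apply: (hf (i, j) s t); apply: conn_mono c => x xf.
  by apply/flattenP; exists (f (i, j)) => //; apply: map_f; rewrite mem_enum.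
have [|M1 h1] := idx_avoid (F := [seq x <- F | x \notin S0]).
  by move=> x; rewrite mem_filter => /andP[].
have [M2 h2] : exists M, forall f, f \in F -> conn (lset S0) q f -> forall i, M <= i ->
    idx i -> cut (Q r) (lset (u i)) f.
  apply: (@uniform_bound _ (fun f M => conn (lset S0) q f -> forall i, M <= i ->
    idx i -> cut (Q r) (lset (u i)) f)).
    by move=> x a b ab hx c i bi; apply: hx => //; exact: leq_trans bi.
  move=> f _; have [c|nc] := pselect (conn (lset S0) q f); last by exists 0.
  by have [M hM] := eventually_cut c; exists M.
have [M3 h3] : exists M, forall a, a \in enum 'I_d -> forall i, M <= i ->
    exists t, h a t \in u i.
  apply: (@uniform_bound _ (fun a M => forall i, M <= i -> exists t, h a t \in u i)).
    by move=> x a b ab hx i bi; apply: hx; exact: leq_trans bi.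
  move=> a _; have [i hi] := u_meets (oh a); exists i => j ij.
  exact: u_later (oh a) ij hi.
(* So late that [u i] misses the part of [F] outside [S0], cuts off the vertices of [F] reachable
   from [q], and meets every [h a]. *)
have [i Mi [si S0i]] := idx_inf (maxn M1 (maxn M2 M3)).
have [M1i M2i M3i] : [/\ M1 <= i, M2 <= i & M3 <= i].
  by move: Mi; rewrite !geq_max => /and3P.
pose on_h y := `[< exists a t, y = h a t >].
pose Y := [seq y <- u i | ~~ on_h y].
have S0Y : lset S0 `<=` lset Y.
  move=> x xS; rewrite /lset /= mem_filter S0i// andbT; apply/asboolPn => -[a [t e]].
  by have := h_off a t; rewrite -e xS.
have hY a t : h a t \notin Y.
  by rewrite mem_filter negb_and negbK; apply/orP; left; apply/asboolP; exists a, t.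
exists Y; split.
  apply: leq_trans si; rewrite size_filter -(count_predC on_h (u i)) leq_add2r.
  by apply: disjoint_hits => // a; apply: h3 => //; rewrite mem_enum.
(* The ray [r] misses [Y], so one can follow it from [q] and cross to [T]. A ray is then followed
   outwards; an anti-ray is entered further out and followed back. *)
have tails T : omega T -> exists2 T', tail T' T &
    forall x, verts T' x -> conn (lset Y) q x.
  move=> oT; have := end_le_mem o (oh i0) oT; rewrite /= -/r => rT.
  have sub (Z1 Z2 : seq D) : lset Z1 `<=` lset (Z1 ++ Z2).
    by move=> x; rewrite /lset /= mem_cat => ->.
  have from_q t' : s0 <= t' -> conn (lset Y) q (r t').
    by move=> st; apply: conn_ray => // [|t _]; [exact: (hh i0).2 | exact/negP/hY].
  case: (end_line o oT) => -[x0].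
    move=> rx0; have [p [hp p0 vT aT _]] := ray_from_seq rx0; rewrite vT in rT.
    have [mT hmT] := eventually_off Y hp.1.
    have [_ [_ [[t' _ <-] [s _ <-] c]]] := rT (Y ++ init p mT ++ init r s0).
    have st' : s0 <= t'.
      apply: (@init_ge D r); apply/negP => e; apply: (conn_notl c).
      by rewrite /lset /= !mem_cat e !orbT.
    have ms : mT <= s.
      apply: (@init_ge D p); apply/negP => e; apply: (conn_notr c).
      by rewrite /lset /= !mem_cat e !orbT.
    exists (seq_ray (ray_shift s hp)); first exact: tail_shift rx0 vT aT.
    move=> _ [t _ <-]; apply: conn_trans (from_q _ st') _.
    apply: conn_trans (conn_mono (sub _ _) c) _.
    apply: conn_ray (leq_addr _ _); first exact: hp.2.
    by move=> z sz; apply/negP/hmT; exact: leq_trans sz.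
  move=> rx0; have [p [ip ep p0 vT aT]] := antiray_to_seq rx0; rewrite vT in rT.
  have [mT hmT] := eventually_off Y ip.
  have [T' tT' vT'] := tail_antishift mT ip ep rx0 vT aT.
  exists T' => // x; rewrite vT' => -[t _ <-].
  have [_ [_ [[t' _ <-] [s _ <-] c]]] := rT (Y ++ init p (mT + t) ++ init r s0).
  have st' : s0 <= t'.
    apply: (@init_ge D r); apply/negP => e; apply: (conn_notl c).
    by rewrite /lset /= !mem_cat e !orbT.
  have ms : mT + t <= s.
    apply: (@init_ge D p); apply/negP => e; apply: (conn_notr c).
    by rewrite /lset /= !mem_cat e !orbT.
  apply: conn_trans (from_q _ st') _; apply: conn_trans (conn_mono (sub _ _) c) _.
  apply: conn_antiray ms => // z sz.
  by apply/negP/hmT; apply: leq_trans sz; exact: leq_addr.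
split=> _ -> T oT; have [T' tT' conT] := tails T oT; exists T' => //; last first.
  move=> s ds; apply: contrapT => no.
  have [|x [v [T'x dv c]]] := @dipath_conn D (lset Y) _ _ s ds.
    by move=> x xs xY; apply: no; exists x.
  apply: (@not_dominates v) dv; apply: conn_mono S0Y _.
  exact: conn_trans (conT x T'x) c.
move=> eta H x me eH rH T'x; apply: contrapT => no.
have [p [hp p0 vH _ _]] := ray_from_seq rH.
have poff t : ~ lset Y (p t) by move=> pY; apply: no; exists (p t); rewrite vH; split => //; exists t.
have cx := conT x T'x; rewrite -p0 in cx.
have [z [hz z0 zoff [a [b ab]]]] := ray_prepend hp poff cx.
have [ee _ _] := me.
have ep : eta (seq_ray hp).
  have lp : linked (verts H) (verts H) by apply: (end_le_mem ee eH eH).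
  apply: (end_memP ee eH); rewrite /= -?vH//.
  by left; exists (p 0); exact: seq_ray_from.
have lz : low_ray z.
  exists hz; split.
  - exists eta => //; by apply: (@shared_tail_mem D eta _ _ hp hz a b ee ab).
  - by move=> t; apply/negP => /S0Y; exact: zoff.
  - by rewrite z0; apply/conn_refl/negP/h_off.
have [zr _] := low_ray_le lz.
have zconn (X : set D) s t : (forall w, s <= w -> ~ X (z w)) -> s <= t -> conn X (z s) (z t).
  by move=> off st; apply: conn_ray => //; exact: hz.2.
(* The ray [z] starts on [h i0] and meets some [g j] by maximality, so it meets [F]. *)
have [t1 zt1 t1max] : exists2 t1, z t1 \in F & forall t, z t \in F -> t <= t1.
  have [tF zF] : exists t, z t \in F.
    apply: contrapT => none; have [s [j [t e]]] := gmax z lz.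
    apply: (hF i0 j s0 t); rewrite -e -/r -/q -z0; apply: zconn => // w _ zw.
    by apply: none; exists w.
  have [M hM] := eventually_off F hz.1.
  apply: (@ex_maximal_nat (fun t => z t \in F) tF M) => // t zt.
  by apply: contraLR zt; rewrite -ltnNge => Mt; apply: hM; exact: ltnW.
have cf : conn (lset S0) q (z t1).
  by rewrite -z0; apply: zconn => // w _ /S0Y; exact: zoff.
(* The vertex [z t1] is cut off by [u i], so [z] meets [u i] from there on; as it misses [Y], it
   does so on some [h a']. *)
have [t2 t12 zt2] : exists2 t2, t1 <= t2 & z t2 \in u i.
  have [m' hm'] := h2 _ zt1 cf i M2i (conj si S0i).
  apply: contrapT => none; apply: hm'; apply: ray_rch => // t tt.
  by apply/negP => zt; apply: none; exists t.
have t12' : t1 < t2.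
  rewrite ltn_neqAle t12 andbT; apply/eqP => e.
  have := h1 i M1i (conj si S0i) (z t1).
  rewrite mem_filter zt1 andbT => /(_ _)/negP; apply; last by rewrite e.
  by apply/negP => /S0Y; exact: zoff.
have [a' [t' e']] : exists a t, z t2 = h a t.
  apply/asboolP/negPn/negP => nh; apply: (zoff t2).
  by rewrite /lset /= mem_filter zt2 andbT.
(* By maximality the rest of [z] meets some [g j]. This gives a walk from [h a'] to [g j] after the
   last visit to [F], which is impossible. *)
have [s [j [t e]]] := gmax _ (low_ray_shift t2 lz).
apply: (hF a' j t' t); rewrite -e -e'; apply: zconn (leq_addr _ _) => w t2w zw.
by have := t1max w zw; rewrite leqNgt (leq_trans t12' t2w).
Qed.
End Separator.

End Upper.

(** * The combined in-degree *)

Import Order.TTheory GRing.Theory Num.Theory.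

(** * Cardinalities and limits inferior *)

Section Ereal.
Variable K : realType.
Local Open Scope ereal_scope.

Lemma counting_seq (T : choiceType) (A : set T) : finite_set A ->
  exists s : seq T, [/\ uniq s, A = [set` s] & counting A = (size s)%:R%:E :> \bar K].
Proof.
move=> fA; exists (fset_set A); split; first exact: fset_uniq.
  by rewrite fset_setK.
by rewrite /counting asboolT.
Qed.

Lemma counting_lset_le (D : digraph) (s : seq D) : counting (lset s) <= (size s)%:R%:E :> \bar K.
Proof.
have [s' [us' e ->]] := counting_seq (finite_seq s).
rewrite lee_fin ler_nat; apply: uniq_leq_size us' _ => x xs'.
by have : [set` s'] x by []; rewrite -e.
Qed.

Lemma limn_einf_le (v : (\bar K)^nat) (N : nat) : (forall i, v i <= N%:R%:E) ->
  limn_einf v <= N%:R%:E.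
Proof.
move=> vN; rewrite limn_einf_lim (cvg_lim _ (@cvg_einfs_sup _ v))//.
apply: ge_ereal_sup => _ [n _ <-]; apply: ge_ereal_inf.
by exists (v n) => //; exists n => //=.
Qed.

Lemma limn_einf_ge (v : (\bar K)^nat) (N m : nat) : (forall i, (m <= i)%N -> N%:R%:E <= v i) ->
  N%:R%:E <= limn_einf v.
Proof.
move=> vN; rewrite limn_einf_lim (cvg_lim _ (@cvg_einfs_sup _ v))//.
apply: le_ereal_sup_tmp; exists (einfs v m); first by exists m.
by apply: le_ereal_inf_tmp => _ [i /= mi <-]; exact: vN.
Qed.

(** The limit inferior is the least value bounding infinitely many terms, or [+oo] if there is
    none. *)
Lemma le_limn_einf_nat (u : nat -> nat) (x : \bar K) :
  (forall k, (forall m, exists2 i, (m <= i)%N & (u i <= k)%N) -> x <= k%:R%:E) ->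
  x <= limn_einf (fun i => (u i)%:R%:E).
Proof.
move=> h; pose P k := forall m, exists2 i, (m <= i)%N & (u i <= k)%N.
have large k : ~ P k -> (k.+1)%:R%:E <= limn_einf (fun i => (u i)%:R%:E : \bar K).
  move=> /existsNP[m nm]; apply: (@limn_einf_ge _ _ m) => i mi.
  rewrite lee_fin ler_nat ltnNge; apply/negP => ui.
  by apply: nm; exists i.
have [[k Pk]|no] := pselect (exists k, P k).
  have [|[|n] Pn nmin] := @ex_minimal_nat P; first by exists k.
    by apply: Order.POrderTheory.le_trans (h _ Pn) _; apply: (@limn_einf_ge _ _ 0) => i _; rewrite lee_fin ler0n.
  apply: Order.POrderTheory.le_trans (h _ Pn) (large _ _) => /nmin.
  by rewrite ltnn.
suff -> : limn_einf (fun i => (u i)%:R%:E : \bar K) = +oo by rewrite leey.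
apply/eqyP => A A0; have [n An] : exists n : nat, (A <= n.+1%:R)%R.
  by exists (Num.truncn A); apply: ltW; apply: real_truncnS_gt; exact: num_real.
apply: Order.POrderTheory.le_trans (large n _); first by rewrite lee_fin.
by move=> Pn; apply: no; exists n.
Qed.
End Ereal.

(** * The in-degree and the two inequalities *)

Section Degree.
Variables (K : realType) (D : digraph) (omega : set (subdigraph D)).
Hypothesis o : is_end omega.

Definition ray_family n : Prop := exists (h : 'I_n -> nat -> D) (hh : forall i, ray_seq (h i)),
  (forall i, omega (seq_ray (hh i))) /\ forall i j s t, h i s = h j t -> i = j.

Lemma ray_family_indegree n : ray_family n -> (n%:R%:E <= indegree K omega)%E.
Proof.
move=> [h [hh [oh dh]]]; pose s := [seq seq_ray (hh i) | i <- enum 'I_n].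
have us : uniq s.
  rewrite map_inj_uniq ?enum_uniq// => i j e.
  have : verts (seq_ray (hh i)) (h i 0) by exists 0.
  by rewrite e => -[t _ /esym/dh].
apply: ereal_sup_ubound; exists [set` s].
  split=> [_ /mapP[i _ ->]|_ _ /mapP[i _ ->] /mapP[j _ ->] [_ [[t _ <-] [t' _ /esym/dh->]]]//].
  by split; [exact: oh | exists (h i 0); exact: seq_ray_from].
have [s' [us' e ->]] := counting_seq K (finite_seq s).
congr (_%:R%:E); rewrite -[RHS](size_enum_ord n) -(size_map (fun i => seq_ray (hh i))) -/s.
apply: perm_size; apply: uniq_perm => // x.
by apply/idP/idP => xs; [have : [set` s'] x by [] | have : [set` s] x by []]; rewrite ?e// -e.
Qed.

Lemma seq_ray_family (s : seq (subdigraph D)) (F : set (subdigraph D)) :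
  F `<=` rays omega -> trivIset F (@verts D) -> uniq s -> (forall T, T \in s -> F T) ->
  ray_family (size s).
Proof.
move=> Fr tF us sF.
have [|h hh] := @choice 'I_(size s) (nat -> D) (fun i h => ray_seq h /\ verts (tnth (in_tuple s) i) = range h).
  move=> i; have [_ [x /ray_from_seq[h [h1 _ h2 _ _]]]] := Fr _ (sF _ (mem_tnth i (in_tuple s))).
  by exists h.
exists h, (fun i => (hh i).1); split=> [i|i j t t' e].
  have sT := sF _ (mem_tnth i (in_tuple s)); have [oT rT] := Fr _ sT.
  have l := end_le_mem o oT oT.
  apply: (end_memP o oT); rewrite /= -?(hh i).2//.
  by left; exists (h i 0); exact: seq_ray_from.
have ij : tnth (in_tuple s) i = tnth (in_tuple s) j.
  apply: tF; [exact: sF _ (mem_tnth i (in_tuple s))|exact: sF _ (mem_tnth j (in_tuple s))|].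
  by exists (h i t); rewrite (hh i).2 (hh j).2; split; [exists t | rewrite e; exists t'].
apply/val_inj/eqP; rewrite /= -(nth_uniq (tnth (in_tuple s) i) _ _ us) //.
by move: ij; rewrite [in RHS](tnth_nth (tnth (in_tuple s) i)) {1}(tnth_nth (tnth (in_tuple s) i)) /= => ->.
Qed.

Lemma indegree_le d : (forall n, ray_family n -> n <= d) -> (indegree K omega <= d%:R%:E)%E.
Proof.
move=> hd; apply: ge_ereal_sup => _ [F [Fr tF] <-].
have small (s : seq (subdigraph D)) : uniq s -> (forall T, T \in s -> F T) -> size s <= d.
  by move=> us sF; apply: hd; exact: seq_ray_family Fr tF us sF.
have [fF|iF] := pselect (finite_set F); last first.
  have [B BF] := infinite_set_fset d.+1 iF.
  by rewrite ltnNge small ?fset_uniq.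
have [s [us e ->]] := counting_seq K fF; rewrite lee_fin ler_nat.
by apply: small => // T Ts; rewrite e.
Qed.

Lemma combined_le_nat (omega_ray : rays omega !=set0) (U : nat -> set D) (u : nat -> seq D) k :
  exhausting omega U -> (forall i, U i = lset (u i)) ->
  (forall m, exists2 i, m <= i & size (u i) <= k) ->
  (combined_indegree K omega <= k%:R%:E)%E.
Proof.
move=> [_ U1 U2] Uu u_small.
have raysE h (hh : ray_seq h) : omega (seq_ray hh) -> rays omega (seq_ray hh).
  by move=> oh; split=> //; exists (h 0); exact: seq_ray_from.
have u_meets h (hh : ray_seq h) : omega (seq_ray hh) -> exists i s, h s \in u i.
  move=> /raysE/U1[i [_ [[s _ <-] Ui]]]; exists i, s.
  by move: Ui; rewrite Uu.
have u_next h (hh : ray_seq h) i : omega (seq_ray hh) ->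
    (exists s, h s \in u i) -> exists s, h s \in u i.+1.
  move=> /raysE/(U2 i) h1 [s hs].
  have [|_ [[t _ <-] Ut]] := h1; first by exists (h s); rewrite Uu; split => //; exists s.
  by exists t; move: Ut; rewrite Uu.
(* Disjoint rays of [omega] meet a late small set in distinct vertices. *)
have bound n : ray_family n -> n <= k.
  move=> [h [hh [oh dh]]].
  have [M hM] : exists M, forall a, a \in enum 'I_n -> forall i, M <= i ->
      exists t, h a t \in u i.
    apply: (@uniform_bound _ (fun a M => forall i, M <= i -> exists t, h a t \in u i)).
      by move=> x a b ab hx i bi; apply: hx; exact: leq_trans bi.
    move=> a _; have [i hi] := u_meets _ _ (oh a); exists i => j ij.
    exact: (u_later u_next (oh a) ij hi).
  have [i Mi si] := u_small M.
  apply: leq_trans si; apply: leq_trans (disjoint_hits dh _) (count_size _ _).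
  by move=> a; apply: hM => //; rewrite mem_enum.
have [T [oT rT]] := omega_ray.
have fam1 : ray_family 1.
  have : ray_family (size [:: T]).
    by apply: (@seq_ray_family _ [set T]) => // [S ->|S S' -> -> //|S]; rewrite ?inE => // /eqP.
  by [].
have [d [h [hh [oh dh]]] dmax] := ex_maximal_nat fam1 bound.
have d0 : 0 < d := dmax _ fam1.
have [S0 [S0inf S0avoid]] := kernel u_small.
(* Tails of the chosen rays avoid [S0] and still form a largest disjoint family. *)
have [m hm] : exists m, forall a, a \in enum 'I_d -> forall t, m <= t -> h a t \notin S0.
  apply: (@uniform_bound _ (fun a m => forall t, m <= t -> h a t \notin S0)).
    by move=> x a b ab hx i bi; apply: hx; exact: leq_trans bi.
  by move=> a _; exact: eventually_off (hh a).1.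
pose hm' (a : 'I_d) t := h a (m + t).
have hh' a : ray_seq (hm' a) := ray_shift m (hh a).
have oh' a : omega (seq_ray (hh' a)).
  by apply: (@shared_tail_mem D omega _ _ (hh a) (hh' a) 0 m o _ (oh a)).
have dh' a b s t : hm' a s = hm' b t -> a = b by exact: dh.
pose i0 := Ordinal d0.
have [iq [s0 q_iq]] := u_meets _ _ (oh' i0).
have [|||Y [dY sepY]] := @separator K D omega o u u_meets u_next k d hm' hh' oh' dh' S0 _ _ _ i0 s0 iq q_iq.
- by move=> n; have [i [ni si Si]] := S0inf n; exists i.
- by move=> F /S0avoid[M hM]; exists M => i Mi [si Si]; exact: hM.
- by move=> a t; apply: hm; rewrite ?mem_enum ?leq_addr.
have dk : (indegree K omega <= d%:R%:E)%E by exact: indegree_le.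
apply: (@Order.POrderTheory.le_trans _ _ (d%:R%:E + (size Y)%:R%:E)%E); last first.
  by rewrite -EFinD -natrD lee_fin ler_nat.
apply: leeD => //; apply: ge_ereal_inf; exists (counting (lset Y)); first by exists (lset Y).
exact: counting_lset_le.
Qed.

Lemma exhausting_le (omega_ray : rays omega !=set0) d (S : seq D) :
  (forall n, ray_family n -> n <= d) ->
  separates (lset S) (end_minus K omega) (dom omega) [set omega] ->
  (ereal_inf [set limn_einf (fun i => counting (U i)) | U in
    [set U : nat -> set D | exhausting omega U]] <= (d + size S)%:R%:E :> \bar K)%E.
Proof.
move=> hd sep; have [R [oR [x0 rR]]] := omega_ray.
have [r [hr r0 vR _ aR]] := ray_from_seq rR.
have deg n (h : 'I_n -> nat -> D) (hh : forall i, ray_seq (h i)) :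
    (forall i, omega (seq_ray (hh i))) ->
    (forall i j s t, h i s = h j t -> i = j) -> n <= d.
  by move=> oh dh; apply: hd; exists h, hh.
have [ms [offS ray_mem nofan]] := no_fans o oR rR hr r0 vR aR deg sep.
have rle T : rays omega T -> linked (verts T) (range r) /\ linked (range r) (verts T).
  by move=> [oT _]; rewrite -vR; split; [exact: (end_le_mem o oT) | exact: (end_le_mem o oR)].
have [V [sV exV]] := exhausting_cuts deg offS ray_mem nofan rle.
apply: ge_ereal_inf; exists (limn_einf (fun i => counting (lset (S ++ V i)))).
  by exists (fun i => lset (S ++ V i)).
apply: limn_einf_le => i.
apply: (Order.POrderTheory.le_trans (counting_lset_le K _)).
by rewrite lee_fin ler_nat size_cat addnC leq_add2r.
Qed.
End Degree.

Theorem theorem1p1 (K : realType) (D : digraph) (omega : set (subdigraph D))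
    (omega_end : is_end omega)
    (omega_ray : rays omega !=set0)
    (omega_countable : forall F : set (subdigraph D),
      F `<=` rays omega -> trivIset F (@verts D) -> countable F) :
  combined_indegree K omega =
  ereal_inf [set limn_einf (fun i => counting (U i)) | U in
    [set U : nat -> set D | exhausting omega U]].
Proof.
apply/eqP; rewrite eq_le; apply/andP; split.
  apply: le_ereal_inf_tmp => _ [U exU <-]; have [fU _ _] := exU.
  have [|u hu] := @choice nat (seq D) (fun i s =>
      U i = lset s /\ counting (U i) = (size s)%:R%:E :> \bar K).
    by move=> i; have [s [_ e c]] := counting_seq K (fU i); exists s.
  have -> : (fun i => counting (U i)) = (fun i => (size (u i))%:R%:E) :> (nat -> \bar K).
    by apply: funext => i; have [_] := hu i.
  apply: le_limn_einf_nat => k small.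
  by apply: (combined_le_nat K omega_end omega_ray exU) => // i; have [] := hu i.
set m := ereal_inf _.
have deg_ge0 : (0 <= indegree K omega)%E.
  apply: ereal_sup_ubound; exists set0; first by split=> // ? ? [].
  by rewrite /counting asboolT// fset_set0 cardfs0.
have inf_ge0 (P : set (set D)) : (0 <= ereal_inf [set counting S | S in P] :> \bar K)%E.
  apply: le_ereal_inf_tmp => _ [S _ <-]; rewrite /counting; case: ifP => _; last exact: le0y.
  by rewrite lee_fin ler0n.
(* An infinite summand makes the bound trivial; otherwise a largest disjoint family and a finite
   separating set give an exhausting sequence. *)
rewrite /combined_indegree; have [->|fin] := eqVneq (indegree K omega) +oo%E.
  by rewrite addye ?leey// gt_eqF// (lt_le_trans _ (inf_ge0 _))// ltNy0.
have finE : indegree K omega \is a fin_num by rewrite ge0_fin_numE// ltey.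
have [b hb] : exists b : nat, forall n, ray_family omega n -> n <= b.
  exists (Num.truncn (fine (indegree K omega))) => n /(ray_family_indegree K).
  by rewrite -{1}(fineK finE) lee_fin => h; rewrite truncn_ge_nat// fine_ge0.
have [|d Pd dmax] := @ex_maximal_nat (ray_family omega) 0 b _ hb.
  have no : 'I_0 -> False by case.
  exists (fun i => False_rect _ (no i)), (fun i => False_rect _ (no i)).
  by split=> [i|i]; case: (no i).
rewrite -leeBlDl//; apply: le_ereal_inf_tmp => _ [S sepS <-]; rewrite leeBlDl//.
have [fS|iS] := pselect (finite_set S); last first.
  by rewrite /counting asboolF// addey ?leey// gt_eqF// (lt_le_trans _ deg_ge0)// ltNy0.
have [s [_ e ->]] := counting_seq K fS; rewrite e in sepS.
apply: le_trans (exhausting_le omega_end omega_ray dmax sepS) _.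
by rewrite natrD EFinD leeD2r// ray_family_indegree.
Qed.
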